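(* Let $R$ be a left Noetherian ring. Let $\mathcal{P}^{<\infty}$ (resp. $\mathcal{GP}^{<\infty}$) be the class of finitely generated $R$-modules of finite projective (resp. finite Gorenstein projective) dimension, and let $\mathrm{findim}(R)=\sup\{\mathrm{pd}_RM: M\in\mathcal{P}^{<\infty}\}$. Then the following are equivalent: (1) $\mathrm{findim}(R)<\infty$. (2) $\mathcal{K}_{\mathfrak{C}}=\mathrm{Add}\,T$ for some tilting $R$-module $T$, where $\mathfrak{C}=\big({}^{\bot}((\mathcal{P}^{<\infty})^{\bot_\infty}),(\mathcal{P}^{<\infty})^{\bot_\infty}\big)$. (3) $\mathcal{K}_{\mathfrak{C}}=\mathrm{Add}\,T$ for some tilting $R$-module $T$, where $\mathfrak{C}=\big({}^{\bot}((\mathcal{GP}^{<\infty})^{\bot_\infty}),(\mathcal{GP}^{<\infty})^{\bot_\infty}\big)$.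
   Context: $R$ is an associative ring with identity; $R$-modules are left $R$-modules. For a class $\mathcal{C}$ of $R$-modules: ${}^{\bot}\mathcal{C}=\{M:\mathrm{Ext}^1_R(M,C)=0\ \forall C\in\mathcal{C}\}$ and $\mathcal{C}^{\bot_\infty}=\{M:\mathrm{Ext}^i_R(C,M)=0\ \forall C\in\mathcal{C},\ i\ge1\}$. For a pair $\mathfrak{C}=(\mathcal{A},\mathcal{B})$, the kernel is $\mathcal{K}_{\mathfrak{C}}=\mathcal{A}\cap\mathcal{B}$. $\mathrm{Add}\,M$ is the class of modules isomorphic to direct summands of arbitrary direct sums of copies of $M$. $\mathrm{pd}_RM$ is the projective dimension of $M$. An $R$-module $T$ (not necessarily finitely generated) is tilting if: (T1) $\mathrm{pd}_RT<\infty$; (T2) $\mathrm{Ext}^i_R(T,T^{(\lambda)})=0$ for all $i\ge1$ and all cardinals $\lambda$; (T3) there is an exact sequence $0\to R\to T_0\to\cdots\to T_r\to0$ with all $T_i\in\mathrm{Add}\,T$, where $r=\mathrm{pd}_RT$. An $R$-module $G$ is Gorenstein projective if $G\cong\ker(f^0)$ for an exact complex $\mathbf{P}:\cdots\to P^{-1}\xrightarrow{f^{-1}}P^0\xrightarrow{f^0}P^1\to\cdots$ of projective modules such that $\mathrm{Hom}_R(\mathbf{P},Q)$ is exact for every projective $Q$. The Gorenstein projective dimension of $G$ is at most $n$ if there is an exact sequence $0\to G_n\to\cdots\to G_0\to G\to0$ with all $G_i$ Gorenstein projective. *)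

(* Defs.v *)
From HB Require Import structures.
From mathcomp Require Import all_boot all_order all_algebra.
From mathcomp Require Import boolp classical_sets functions cardinality.

Set Implicit Arguments.
Unset Strict Implicit.
Unset Printing Implicit Defensive.

Import GRing.Theory.

Local Open Scope classical_set_scope.
Local Open Scope ring_scope.

(* Rings are [pzRingType]s, so that the zero ring is allowed;
   [lmodType R] is the type of left R-modules. *)

Definition mod_class (R : pzRingType) := lmodType R -> Prop.

Section DirectSum.
Variables (R : pzRingType) (I : Type) (M : lmodType R).

Definition fin_supp : {pred I -> M} :=
  fun f => `[< finite_set [set i | f i <> 0] >].

Lemma fin_supp_submod_closed : submod_closed fin_supp.
Proof.
split=> [|a f g /asboolP ff /asboolP fg]; apply/asboolP.
  by rewrite (_ : [set _ | _] = set0) //; apply/seteqP; split.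
apply: (@sub_finite_set _ _ ([set i | f i <> 0] `|` [set i | g i <> 0])).
  move=> i /= afg0; have [fi0|] := pselect (f i = 0); last by left.
  right=> gi0; apply: afg0.
  by rewrite -[LHS]/(a *: f i + g i) fi0 gi0 scaler0 addr0.
by rewrite finite_setU.
Qed.

HB.instance Definition _ :=
  GRing.isSubmodClosed.Build R (I -> M) fin_supp fin_supp_submod_closed.

(* The direct sum M^(I) of I copies of M, with pointwise operations. *)
Record dsum := DSum { dsum_val :> I -> M; _ : dsum_val \in fin_supp }.

HB.instance Definition _ := [isSub for dsum_val].
HB.instance Definition _ := [Choice of dsum by <:].
HB.instance Definition _ := [SubChoice_isSubLmodule of dsum by <:].

End DirectSum.

(* The infimum in N u {oo} of a set of natural numbers, None standing for oo. *)
Definition inf_enat (S : nat -> Prop) : option nat :=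
  if pselect (exists n, `[< S n >]) is left e then Some (ex_minn e) else None.

Section Modules.
Variable R : pzRingType.

Definition finitely_generated (M : lmodType R) : Prop :=
  exists (n : nat) (v : 'I_n -> M),
    forall x : M, exists c : 'I_n -> R, x = \sum_(k < n) c k *: v k.

Definition left_noetherian : Prop :=
  forall J : {pred R^o}, submod_closed J ->
    exists (n : nat) (a : 'I_n -> R^o), (forall k, a k \in J) /\
      forall x, x \in J -> exists c : 'I_n -> R, x = \sum_(k < n) c k *: a k.

Definition trivial_mod (M : lmodType R) : Prop := forall x : M, x = 0.

Definition exact (L M N : lmodType R)
    (f : {linear L -> M}) (g : {linear M -> N}) : Prop :=
  forall y : M, g y = 0 <-> exists x : L, f x = y.

Definition projective : mod_class R := fun P =>
  forall (M N : lmodType R) (p : {linear M -> N}) (f : {linear P -> N}),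
    (forall y : N, exists x : M, p x = y) ->
    exists h : {linear P -> M}, forall x, p (h x) = f x.

(* X is in Add M iff X (+) Y is isomorphic to some M^(I). *)
Definition Add (M : lmodType R) : mod_class R := fun X =>
  exists (I : Type) (Y : lmodType R)
    (f : {linear (X * Y)%type -> dsum I M}), bijective f.

(* ... -> P 1 -> P 0 -> M -> 0 is exact. *)
Definition resolution (P : nat -> lmodType R)
    (d : forall i, {linear P i.+1 -> P i})
    (M : lmodType R) (e : {linear P 0%N -> M}) : Prop :=
  [/\ forall y : M, exists x, e x = y,
      exact (d 0%N) e
    & forall i, exact (d i.+1) (d i)].

(* There is an exact sequence 0 -> P n -> ... -> P 0 -> M -> 0
   with all P i in C. *)
Definition res_dim_le (C : mod_class R) (M : lmodType R) (n : nat) : Prop :=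
  exists (P : nat -> lmodType R) (d : forall i, {linear P i.+1 -> P i})
    (e : {linear P 0%N -> M}),
    [/\ resolution d e,
        forall i, (i <= n)%N -> C (P i)
      & forall i, (n < i)%N -> trivial_mod (P i)].

(* The zero module has projective dimension 0. *)
Definition pd (M : lmodType R) : option nat :=
  inf_enat (res_dim_le projective M).

(* H^i(Hom(P, N)) = 0, where P is the complex ... -> P 1 -> P 0 -> 0. *)
Definition Hom_cohomology_eq0 (P : nat -> lmodType R)
    (d : forall i, {linear P i.+1 -> P i}) (N : lmodType R) (i : nat) : Prop :=
  match i with
  | 0 => forall f : {linear P 0%N -> N}, (forall x, f (d 0%N x) = 0) ->
      forall x, f x = 0
  | j.+1 => forall f : {linear P j.+1 -> N}, (forall x, f (d j.+1 x) = 0) ->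
      exists g : {linear P j -> N}, forall x, f x = g (d j x)
  end.

(* Ext^i_R(M, N) = 0.  Every module has a projective resolution, and
   H^i(Hom(P, N)) does not depend on the choice of the resolution P. *)
Definition Ext_eq0 (i : nat) (M N : lmodType R) : Prop :=
  forall (P : nat -> lmodType R) (d : forall k, {linear P k.+1 -> P k})
    (e : {linear P 0%N -> M}),
    (forall k, projective (P k)) -> resolution d e ->
    Hom_cohomology_eq0 d N i.

Definition perp1_left (C : mod_class R) : mod_class R := fun M =>
  forall N, C N -> Ext_eq0 1 M N.

Definition perp_infty_right (C : mod_class R) : mod_class R := fun M =>
  forall N, C N -> forall i, (1 <= i)%N -> Ext_eq0 i N M.

Definition kernel (AB : mod_class R * mod_class R) : mod_class R := fun M =>
  AB.1 M /\ AB.2 M.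

(* There is an exact sequence 0 -> R -> T_ 0 -> ... -> T_ r -> 0
   with all T_ i in C. *)
Definition ring_coresolution (C : mod_class R) (r : nat) : Prop :=
  exists (T_ : nat -> lmodType R) (d : forall i, {linear T_ i -> T_ i.+1})
    (e : {linear R^o -> T_ 0%N}),
    [/\ injective e,
        exact e (d 0%N),
        forall i, exact (d i) (d i.+1),
        forall i, (i <= r)%N -> C (T_ i)
      & forall i, (r < i)%N -> trivial_mod (T_ i)].

Definition tilting (T : lmodType R) : Prop :=
  exists r : nat,
    [/\ pd T = Some r,
        forall (i : nat) (I : Type), (1 <= i)%N -> Ext_eq0 i T (dsum I T)
      & ring_coresolution (Add T) r].

Definition Gorenstein_projective : mod_class R := fun G =>
  exists (P : int -> lmodType R) (d : forall i, {linear P i -> P (i + 1)}),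
    [/\ forall i, projective (P i),
        forall i, exact (d i) (d (i + 1)),
        (* Hom(P, Q) is exact for all projective Q *)
        forall Q, projective Q ->
          forall i (f : {linear P (i + 1) -> Q}),
            (forall x, f (d i x) = 0) <->
            exists g : {linear P (i + 1 + 1) -> Q},
              forall x, f x = g (d (i + 1) x)
      & (* G is isomorphic to the kernel of d 0 *)
        exists u : {linear G -> P 0}, injective u /\ exact u (d 0)].

Definition Gpd (M : lmodType R) : option nat :=
  inf_enat (res_dim_le Gorenstein_projective M).

Definition fin_pd : mod_class R := fun M =>
  finitely_generated M /\ pd M <> None.

Definition fin_Gpd : mod_class R := fun M =>
  finitely_generated M /\ Gpd M <> None.

(* The supremum in N u {oo} of the pd M for M in fin_pd, as the infimum of
   the upper bounds. *)
Definition findim : option nat :=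
  inf_enat (fun n =>
    forall M, fin_pd M -> forall m, pd M = Some m -> (m <= n)%N).

Definition perp_pair (C : mod_class R) : mod_class R * mod_class R :=
  (perp1_left (perp_infty_right C), perp_infty_right C).

End Modules.

(* Main.v *)
Require Import Defs.
From HB Require Import structures.
From mathcomp Require Import all_boot all_order all_algebra.
From mathcomp Require Import boolp classical_sets functions cardinality.

Set Implicit Arguments.
Unset Strict Implicit.
Unset Printing Implicit Defensive.

Import GRing.Theory.

Local Open Scope classical_set_scope.
Local Open Scope ring_scope.

(* Let FP and GFP be the classes of finitely generated modules of finite
   projective, resp. Gorenstein projective, dimension.

   If T is tilting and Add T lies in the right class of either pair, then every
   N with Ext^i(T, N) = 0 for i >= 1 has an infinite resolution by sums of
   copies of T with kernels of the same kind, so dimension shifting gives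
   Ext^i(M, N) = 0 for M in FP and i >= 1.  For an arbitrary N, apply this to
   the r-th cosyzygy of N, r = pd T: hence pd M <= pd T and findim R <= pd T.

   Conversely, if findim R = n, coresolve R by special preenvelopes, which over
   a left Noetherian ring exist by an omega-step small object argument.  After
   n steps the cokernel lies in the kernel of the cotorsion pair of FP, and T
   is the product of the terms.  Minimality of n and the first part give
   pd T = n.  The same T works for GFP: a module M in GFP fits into
   0 -> M -> H -> G -> 0 with H in FP and G finitely generated Gorenstein
   projective, and Ext^i(G, -) vanishes for i >= 1 on the modules of finite
   projective dimension, so both pairs have the same kernel.

   Enough injectives come from the same small object argument and Baer's
   criterion; they turn every statement on higher Ext into one on Ext^1. *)

(** * Submodules and quotients *)

Section LinearMaps.
Variable R : pzRingType.
Implicit Types (A B C M N X : lmodType R).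

(** The finite projective dimension of M in FP serves to stop the shifting along covers by copies of
    T; the bound itself comes from T, because Ext^(r+1)(M, N) = Ext^1(M, Y) with Y the r-th cosyzygy
    of N, and Ext^i(T, Y) = Ext^(i+r)(T, N) = 0 for i >= 1. The Noetherian hypothesis enters through
    one fact: the kernel K of a cover of a finitely generated module by a free module of finite rank
    is again finitely generated. Hence a map from K into an increasing countable union factors
    through a stage, a map from K into a direct sum has finitely many nonzero components, so that
    sums of copies of T stay in the right class, and FP is closed under syzygies, so that
    preenvelopes controlling Ext^1 control every Ext^i. Preenvelopes are built for FP and not for
    GFP. In the Gorenstein case the delicate point is instead that a cover of a module of the GFP
    kernel has its own kernel orthogonal to GFP, while the cover is known to behave well with
    respect to FP alone. *)

Definition surj A B (f : A -> B) : Prop := forall y, exists x, f x = y.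

Definition submodule M (K : set M) : Prop :=
  K 0 /\ forall (a : R) x y, K x -> K y -> K (a *: x + y).

Lemma linear_ex A B (f : A -> B) :
  (forall a x y, f (a *: x + y) = a *: f x + f y) ->
  exists h : {linear A -> B}, forall x, h x = f x.
Proof.
move=> fL; pose h : {linear A -> B} := HB.pack f (GRing.isLinear.Build _ _ _ _ f fL).
by exists h.
Qed.

Lemma factor_inj A B X (i : {linear A -> B}) (g : {linear X -> B}) :
  injective i -> (forall x, exists a, i a = g x) ->
  exists h : {linear X -> A}, forall x, i (h x) = g x.
Proof.
move=> ii /choice[h hP]; have [|h' h'E] := @linear_ex X A h.
  by move=> a x y; apply: ii; rewrite linearP !hP linearP.
by exists h' => x; rewrite h'E.
Qed.

Lemma factor_surj B M X (p : {linear B -> M}) (g : {linear B -> X}) :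
  surj p -> (forall b, p b = 0 -> g b = 0) ->
  exists h : {linear M -> X}, forall b, h (p b) = g b.
Proof.
move=> /choice[s sP] pg.
have gE b b' : p b = p b' -> g b = g b'.
  by move=> e; apply/subr0_eq; rewrite -linearB pg // linearB e subrr.
have [|h' h'E] := @linear_ex M X (fun m => g (s m)).
  by move=> a x y; rewrite -linearP; apply: gE; rewrite linearP !sP.
by exists h' => x; rewrite h'E; apply: gE; rewrite sP.
Qed.

Lemma submoduleD M (K : set M) x y : submodule K -> K x -> K y -> K (x + y).
Proof. by move=> [_ KL] Kx Ky; rewrite -[x]scale1r; exact: KL. Qed.

Lemma submoduleZ M (K : set M) a x : submodule K -> K x -> K (a *: x).
Proof. by move=> [K0 KL] Kx; rewrite -[_ *: _]addr0; exact: KL. Qed.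

Lemma submoduleN M (K : set M) x : submodule K -> K x -> K (- x).
Proof. by move=> sK Kx; rewrite -scaleN1r; exact: submoduleZ. Qed.

Lemma submoduleB M (K : set M) x y : submodule K -> K x -> K y -> K (x - y).
Proof. by move=> sK Kx Ky; apply: submoduleD => //; exact: submoduleN. Qed.

Lemma submodule_sum M (K : set M) (I : Type) (r : seq I) (F : I -> M) :
  submodule K -> (forall i, K (F i)) -> K (\sum_(i <- r) F i).
Proof.
move=> sK KF; elim: r => [|i r IH]; first by rewrite big_nil; case: sK.
by rewrite big_cons; apply: submoduleD.
Qed.

Lemma submodule_preim M N (f : {linear M -> N}) (K : set N) :
  submodule K -> submodule (fun x => K (f x)).
Proof.
move=> [K0 KL]; split; first by rewrite linear0.
by move=> a x y Kx Ky; rewrite linearP; exact: KL.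
Qed.

Lemma submodule_im M N (f : {linear M -> N}) (K : set M) :
  submodule K -> submodule (fun y => exists2 x, K x & f x = y).
Proof.
move=> [K0 KL]; split; first by exists 0; rewrite ?linear0.
by move=> a _ _ [x Kx <-] [y Ky <-]; exists (a *: x + y); rewrite ?linearP//; exact: KL.
Qed.

Lemma submodule_range M N (f : {linear M -> N}) :
  submodule (fun y => exists x, f x = y).
Proof.
split; first by exists 0; rewrite linear0.
by move=> a _ _ [x <-] [y <-]; exists (a *: x + y); rewrite linearP.
Qed.

Lemma submodule_ker M N (f : {linear M -> N}) : submodule (fun x => f x = 0).
Proof.
split; first by rewrite linear0.
by move=> a x y /= fx fy; rewrite linearP fx fy scaler0 addr0.
Qed.

Lemma submodule_eq M N (f g : {linear M -> N}) : submodule (fun x => f x = g x).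
Proof.
split; first by rewrite !linear0.
by move=> a x y /= fx fy; rewrite !linearP fx fy.
Qed.

Lemma inj0P M N (f : {linear M -> N}) : (forall x, f x = 0 -> x = 0) -> injective f.
Proof. by move=> f0 x y e; apply/subr0_eq/f0; rewrite linearB e subrr. Qed.

End LinearMaps.

Section SubModule.
Variables (R : pzRingType) (V : lmodType R) (K : set V) (sK : submodule K).

(** The proof of [submodule K] is an argument of the predicate so that the closure instance, which
    needs it, can be declared on the predicate itself. *)
Definition in_submodule of submodule K : {pred V} := fun x => `[< K x >].

Lemma in_submodule_closed : submod_closed (in_submodule sK).
Proof.
case: sK => K0 KL; split=> [|a x y /asboolP Kx /asboolP Ky]; apply/asboolP => //.
exact: KL.
Qed.

HB.instance Definition _ :=
  GRing.isSubmodClosed.Build R V (in_submodule sK) in_submodule_closed.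

Record submod := Submod { submod_val :> V; _ : submod_val \in in_submodule sK }.

HB.instance Definition _ := [isSub for submod_val].
HB.instance Definition _ := [Choice of submod by <:].
HB.instance Definition _ := [SubChoice_isSubLmodule of submod by <:].

(** Interface to the construction: later arguments see a submodule as an injective map with
    prescribed image, and likewise a quotient as a surjection with prescribed kernel. *)
Lemma submodule_ex : exists (S : lmodType R) (i : {linear S -> V}),
  injective i /\ forall x, K x <-> exists y, i y = x.
Proof.
have [|h hE] := @linear_ex R submod V submod_val.
  by move=> a x y; exact: (linearP (val : submod -> V)).
exists submod, h; split=> [x y|x].
  by rewrite !hE => e; exact: val_inj.
split=> [Kx|[y <-]]; last by rewrite hE; case: y => y /= /asboolP.
have Kx' : x \in in_submodule sK by exact/asboolP.
by exists (Submod Kx'); rewrite hE.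
Qed.

End SubModule.

Section QuotModule.
Variables (R : pzRingType) (V : lmodType R) (K : set V) (sK : submodule K).

(** Equal cosets are equal sets, so [xget] picks the same representative in them; a quotient is then
    the subtype of chosen representatives. *)
Definition coset_rep of submodule K := fun x : V => xget x [set y | K (x - y)].

Let rep := coset_rep sK.

Lemma coset_repP x : K (x - rep x).
Proof.
rewrite /rep /coset_rep; case: xgetP => [y -> //|/(_ x)[]] /=.
by rewrite subrr; exact: (proj1 sK).
Qed.

Lemma coset_rep_eq x y : K (x - y) -> rep x = rep y.
Proof.
move=> Kxy; rewrite /rep /coset_rep.
have E : [set z | K (x - z)] = [set z | K (y - z)].
  apply/seteqP; split=> z /= Kz.
    by rewrite (_ : y - z = (x - z) - (x - y));
      [exact: submoduleB|rewrite opprB [RHS]addrC addrA subrK].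
  by rewrite (_ : x - z = (x - y) + (y - z)); [exact: submoduleD|rewrite addrA subrK].
rewrite E /xget; case: pselect => // -[].
by exists y; apply/asboolP; rewrite /= subrr; exact: (proj1 sK).
Qed.

Lemma coset_rep_id x : rep (rep x) = rep x.
Proof. by apply/esym/coset_rep_eq/coset_repP. Qed.

Definition is_coset_rep of submodule K : pred V := fun x => rep x == x.

Record quot := Quot { quot_val : V; _ : is_coset_rep sK quot_val }.

HB.instance Definition _ := [isSub for quot_val].
HB.instance Definition _ := [Choice of quot by <:].

Definition quot_pi (x : V) : quot := @Quot (rep x) (introT eqP (coset_rep_id x)).

Lemma quot_eq (x y : V) : K (x - y) <-> quot_pi x = quot_pi y.
Proof.
split=> [e|/(congr1 val)/= e]; first by apply: val_inj; exact: coset_rep_eq.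
rewrite (_ : x - y = (x - rep x) - (y - rep y)); last by rewrite e opprB addrA subrK.
by apply: submoduleB => //; exact: coset_repP.
Qed.

Lemma quot_valK (q : quot) : quot_pi (val q) = q.
Proof. by apply: val_inj => /=; apply/eqP/(valP q). Qed.

Definition quot_add (p q : quot) := quot_pi (val p + val q).
Definition quot_opp (p : quot) := quot_pi (- val p).
Definition quot_scale (a : R) (p : quot) := quot_pi (a *: val p).

Lemma quot_addE x y : quot_add (quot_pi x) (quot_pi y) = quot_pi (x + y).
Proof.
apply/esym/quot_eq; rewrite opprD addrACA.
by apply: submoduleD => //; exact: coset_repP.
Qed.

Lemma quot_oppE x : quot_opp (quot_pi x) = quot_pi (- x).
Proof.
apply/esym/quot_eq; rewrite -opprD.
by apply: submoduleN => //; exact: coset_repP.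
Qed.

Lemma quot_scaleE a x : quot_scale a (quot_pi x) = quot_pi (a *: x).
Proof.
apply/esym/quot_eq; rewrite -scalerBr.
by apply: submoduleZ => //; exact: coset_repP.
Qed.

Lemma quot_ind (P : quot -> Prop) : (forall x, P (quot_pi x)) -> forall q, P q.
Proof. by move=> PP q; rewrite -(quot_valK q). Qed.

Lemma quot_addA : associative quot_add.
Proof.
by elim/quot_ind=> x; elim/quot_ind=> y; elim/quot_ind=> z; rewrite !quot_addE addrA.
Qed.
Lemma quot_addC : commutative quot_add.
Proof. by elim/quot_ind=> x; elim/quot_ind=> y; rewrite !quot_addE addrC. Qed.
Lemma quot_add0 : left_id (quot_pi 0) quot_add.
Proof. by elim/quot_ind=> x; rewrite !quot_addE add0r. Qed.
Lemma quot_addN : left_inverse (quot_pi 0) quot_opp quot_add.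
Proof. by elim/quot_ind=> x; rewrite quot_oppE !quot_addE addNr. Qed.

HB.instance Definition _ :=
  GRing.isZmodule.Build quot quot_addA quot_addC quot_add0 quot_addN.

Lemma quot_scaleA a b q : quot_scale a (quot_scale b q) = quot_scale (a * b) q.
Proof. by elim/quot_ind: q => x; rewrite !quot_scaleE scalerA. Qed.
Lemma quot_scale1 : left_id 1 quot_scale.
Proof. by elim/quot_ind=> x; rewrite !quot_scaleE scale1r. Qed.
Lemma quot_scaleDr : right_distributive quot_scale +%R.
Proof.
move=> a; elim/quot_ind=> x; elim/quot_ind=> y.
by rewrite -[_ + _]/(quot_add _ _) -[RHS]/(quot_add _ _) !(quot_addE, quot_scaleE) scalerDr.
Qed.
Lemma quot_scaleDl q : {morph (quot_scale^~ q) : a b / a + b}.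
Proof.
elim/quot_ind: q => x a b; rewrite -[RHS]/(quot_add _ _).
by rewrite !(quot_addE, quot_scaleE) scalerDl.
Qed.

HB.instance Definition _ := GRing.Zmodule_isLmodule.Build R quot
  quot_scaleA quot_scale1 quot_scaleDr quot_scaleDl.

Lemma quotient_ex : exists (Q : lmodType R) (p : {linear V -> Q}),
  surj p /\ forall x, p x = 0 <-> K x.
Proof.
have [|h hE] := @linear_ex R V quot quot_pi.
  by move=> a x y; rewrite -[_ + _ in RHS]/(quot_add _ _) -[_ *: _ in RHS]/(quot_scale _ _)
     quot_scaleE quot_addE.
exists quot, h; split=> [q|x]; first by exists (val q); rewrite hE quot_valK.
rewrite hE -[0 in X in X <-> _]/(quot_pi 0).
by rewrite -[in X in _ <-> X](subr0 x); split => /quot_eq.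
Qed.

End QuotModule.
(** * Direct sums *)

Section ProdModule.
Variables (R : pzRingType) (I : Type) (M : I -> lmodType R).

Definition dprod := forall i, M i.

HB.instance Definition _ := gen_eqMixin dprod.
HB.instance Definition _ := gen_choiceMixin dprod.

Let dext (f g : dprod) : (forall i, f i = g i) -> f = g.
Proof. exact: functional_extensionality_dep. Qed.

Fact dprod_addA : associative (fun f g : dprod => (fun i => f i + g i) : dprod).
Proof. by move=> f g h; apply: dext => i; rewrite addrA. Qed.
Fact dprod_addC : commutative (fun f g : dprod => (fun i => f i + g i) : dprod).
Proof. by move=> f g; apply: dext => i; rewrite addrC. Qed.
Fact dprod_add0 : left_id ((fun=> 0) : dprod) (fun f g => (fun i => f i + g i) : dprod).
Proof. by move=> f; apply: dext => i; rewrite add0r. Qed.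
Fact dprod_addN : left_inverse ((fun=> 0) : dprod) (fun f => (fun i => - f i) : dprod)
  (fun f g => (fun i => f i + g i) : dprod).
Proof. by move=> f; apply: dext => i; rewrite addNr. Qed.

HB.instance Definition _ :=
  GRing.isZmodule.Build dprod dprod_addA dprod_addC dprod_add0 dprod_addN.

Fact dprod_scaleA a b (f : dprod) :
  (fun i => a *: (b *: f i)) = (fun i => (a * b) *: f i) :> dprod.
Proof. by apply: dext => i; rewrite scalerA. Qed.
Fact dprod_scale1 (f : dprod) : (fun i => 1 *: f i) = f.
Proof. by apply: dext => i; rewrite scale1r. Qed.
Fact dprod_scaleDr (a : R) (f g : dprod) :
  (fun i => a *: (f i + g i)) = ((fun i => a *: f i) : dprod) + (fun i => a *: g i).
Proof. by apply: dext => i; rewrite scalerDr. Qed.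
Fact dprod_scaleDl (f : dprod) (a b : R) :
  (fun i => (a + b) *: f i) = ((fun i => a *: f i) : dprod) + (fun i => b *: f i).
Proof. by apply: dext => i; rewrite scalerDl. Qed.

HB.instance Definition _ := GRing.Zmodule_isLmodule.Build R dprod
  dprod_scaleA dprod_scale1 dprod_scaleDr dprod_scaleDl.

Lemma dprod_ex : exists (P : lmodType R) (pr : forall i, {linear P -> M i}),
  (forall d, (forall i, pr i d = 0) -> d = 0) /\
  (forall f : forall i, M i, exists d, forall i, pr i d = f i).
Proof.
have H i : exists h : {linear dprod -> M i}, forall x, h x = x i by exact: linear_ex.
exists dprod, (fun i => projT1 (cid (H i))); split=> [d d0|f].
  by apply: dext => i; move: (d0 i); case: (cid _) => /= h ->.
by exists f => i; case: (cid _) => /= h ->.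
Qed.

End ProdModule.

Section DirectSums.
Variable R : pzRingType.

(** An axiomatic description, so that [dsum I T] and sums of varying summands are treated alike.
    [dsum_in] is the map into a sum given by a pointwise finite family; the dual universal property
    is derived from the other fields. *)
Record is_dsum (I : Type) (M : I -> lmodType R) (D : lmodType R)
    (inj : forall i, {linear M i -> D}) (pr : forall i, {linear D -> M i}) : Prop :=
  IsDsum {
    dsum_prK : forall i x, pr i (inj i x) = x;
    dsum_pr0 : forall i j x, i <> j -> pr i (inj j x) = 0;
    dsum_ext : forall d, (forall i, pr i d = 0) -> d = 0;
    dsum_fin : forall d, finite_set [set i | pr i d <> 0];
    dsum_in : forall (A : lmodType R) (g : forall i, {linear A -> M i}),
      (forall a, finite_set [set i | g i a <> 0]) ->
      exists h : {linear A -> D}, forall i a, pr i (h a) = g i a }.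

Section Theory.
Variables (I : Type) (M : I -> lmodType R) (D : lmodType R).
Variables (inj : forall i, {linear M i -> D}) (pr : forall i, {linear D -> M i}).
Hypothesis dD : is_dsum inj pr.

Let J : choiceType := {classic I}.

Lemma dsum_seq d : exists s : seq J, uniq s /\ forall i : J, pr i d <> 0 -> i \in s.
Proof.
have /finite_seqP[s sE] : finite_set ([set i | pr i d <> 0] : set J) by exact: (dsum_fin dD d).
exists (undup s); split; first exact: undup_uniq.
move=> i id0; rewrite mem_undup.
by have : ([set` s] : set J) i by rewrite -sE.
Qed.

Let S (N : lmodType R) (g : forall i, {linear M i -> N}) (s : seq J) d :=
  \sum_(i <- s) g i (pr i d).

(** Terms off the support vanish, so the sum may be taken over any duplicate-free list containing
    the support; linearity is then checked on one list serving three elements. *)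
Let S_eq (N : lmodType R) (g : forall i, {linear M i -> N}) (s s' : seq J) d :
  uniq s -> uniq s' -> (forall i : J, pr i d <> 0 -> i \in s) ->
  (forall i : J, pr i d <> 0 -> i \in s') -> S g s d = S g s' d.
Proof.
move=> us us' ds ds'.
have E (t : seq J) : S g t d = S g [seq i <- t | pr i d != 0] d.
  rewrite /S big_filter [RHS]big_mkcond; apply: eq_bigr => i _.
  by case: eqP => // ->; rewrite linear0.
rewrite E [RHS]E; apply: perm_big; apply: uniq_perm; rewrite ?filter_uniq// => i.
by rewrite !mem_filter; case: eqP => //= /[dup] /ds -> /ds' ->.
Qed.

Lemma dsum_out (N : lmodType R) (g : forall i, {linear M i -> N}) :
  exists h : {linear D -> N}, forall i x, h (inj i x) = g i x.
Proof.
have /choice[s sP] := dsum_seq.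
have [|h hE] := @linear_ex R D N (fun d => S g (s d) d).
  move=> a x y; pose t : seq J := undup (s x ++ s y ++ s (a *: x + y)).
  have ut : uniq t by exact: undup_uniq.
  have E z : (forall i : J, i \in s z -> i \in t) -> S g (s z) z = S g t z.
    move=> zt; apply: S_eq => //; [exact: (sP z).1|exact: (sP z).2|].
    by move=> i /((sP z).2 i); exact: zt.
  rewrite !E; first last.
  - by move=> i ii; rewrite mem_undup !mem_cat ii ?orbT.
  - by move=> i ii; rewrite mem_undup !mem_cat ii ?orbT.
  - by move=> i ii; rewrite mem_undup !mem_cat ii ?orbT.
  by rewrite /S scaler_sumr -big_split; apply: eq_bigr => i _ /=; rewrite !linearP.
exists h => i x; rewrite hE (@S_eq _ _ _ [:: (i : J)]).
- by rewrite /S big_seq1 (dsum_prK dD).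
- exact: (sP _).1.
- by [].
- exact: (sP _).2.
- move=> j; rewrite inE; case: (pselect (j = i)) => [->|ji]; first by rewrite eqxx.
  by rewrite (dsum_pr0 dD).
Qed.

Lemma dsum_gen (K : set D) : submodule K -> (forall i x, K (inj i x)) -> forall d, K d.
Proof.
move=> sK Ki d; have [s [us ds]] := dsum_seq d.
suff -> : d = \sum_(i <- s) inj i (pr i d) by apply: submodule_sum.
apply/subr0_eq/(dsum_ext dD) => i; rewrite linearB linear_sum.
have [si|nis] := boolP ((i : J) \in s).
  rewrite (bigD1_seq (i : J)) //= (dsum_prK dD) big1 ?addr0 ?subrr// => j /eqP ji.
  by rewrite (dsum_pr0 dD)// => ij; apply: ji.
rewrite big1_seq ?subr0; first by apply: contrapT => /ds; rewrite (negbTE nis).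
move=> j /= js; rewrite (dsum_pr0 dD)// => ij.
by move: nis; rewrite ij js.
Qed.

Lemma dsum_hom_eq (N : lmodType R) (g h : {linear D -> N}) :
  (forall i x, g (inj i x) = h (inj i x)) -> forall d, g d = h d.
Proof. by move=> gh; apply: dsum_gen => //; exact: submodule_eq. Qed.

End Theory.

Lemma is_dsum_ex (I : Type) (M : I -> lmodType R) : exists (D : lmodType R)
  (inj : forall i, {linear M i -> D}) (pr : forall i, {linear D -> M i}), is_dsum inj pr.
Proof.
have [P [pr [P0 PE]]] := dprod_ex M.
have sK : submodule (fun d : P => finite_set [set i | pr i d <> 0]).
  split=> [|a x y fx fy].
    by rewrite (_ : [set _ | _] = set0) //; apply/seteqP; split=> // i /=; rewrite linear0.
  apply: (@sub_finite_set _ _ ([set i | pr i x <> 0] `|` [set i | pr i y <> 0])).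
    move=> i /=; rewrite linearP; have [->|] := pselect (pr i x = 0); last by left.
    by rewrite scaler0 add0r; right.
  by rewrite finite_setU.
have [D [u [ui uP]]] := submodule_ex sK.
have inP i : exists h : {linear M i -> D}, forall x,
    pr i (u (h x)) = x /\ forall j, j <> i -> pr j (u (h x)) = 0.
  have H (x : M i) : exists d : P, pr i d = x /\ forall j, j <> i -> pr j d = 0.
    have [d dE] := PE (fun j => if pselect (i = j) is left e then
                         eq_rect i (fun k => M k : Type) x j e else 0).
    exists d; split=> [|j ji]; rewrite dE; case: pselect => //.
      by move=> e; rewrite (Prop_irrelevance e erefl).
    by move=> e; case: ji.
  have /choice[f fP] := H.
  have [|f' f'E] := @linear_ex R (M i) P f.
    move=> a x y; apply/subr0_eq/P0 => j; rewrite linearB linearP.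
    case: (pselect (j = i)) => [->|ji]; first by rewrite !(fP _).1 subrr.
    by rewrite !(fP _).2// scaler0 addr0 subr0.
  have [x|h hE] := factor_inj (g := f') ui.
    apply/uP/(@sub_finite_set _ _ [set i]) => //.
    by move=> j /= jx; apply: contrapT => ji; apply: jx; rewrite f'E (fP x).2.
  by exists h => x; rewrite hE f'E.
have prP i : exists h : {linear D -> M i}, forall x, h x = pr i (u x).
  by apply: linear_ex => a x y; rewrite !linearP.
exists D, (fun i => projT1 (cid (inP i))), (fun i => projT1 (cid (prP i))); split.
- move=> i x; case: (cid (prP i)) => q /= qE; case: (cid (inP i)) => h /= hP.
  by rewrite qE (hP x).1.
- move=> i j x ij; case: (cid (prP i)) => q /= qE; case: (cid (inP j)) => h /= hP.
  by rewrite qE (hP x).2.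
- move=> d d0; apply: ui; rewrite linear0; apply: P0 => i.
  by have := d0 i; case: (cid (prP i)) => q /= ->.
- move=> d; suff -> : [set i | projT1 (cid (prP i)) d <> 0] = [set i | pr i (u d) <> 0].
    by apply/uP; exists d.
  by apply/seteqP; split=> i /=; case: (cid (prP i)) => q /= ->.
- move=> A g fg.
  have /choice[f fP] : forall a, exists d : P, forall i, pr i d = g i a.
    by move=> a; exact: PE.
  have [|f' f'E] := @linear_ex R A P f.
    by move=> a x y; apply/subr0_eq/P0 => i; rewrite linearB linearP !fP linearP subrr.
  have [x|h hE] := factor_inj (g := f') ui.
    apply/uP; rewrite (_ : [set _ | _] = [set i | g i x <> 0]) //.
    by apply/seteqP; split=> i /=; rewrite f'E fP.
  by exists h => i a; case: (cid (prP i)) => q /= ->; rewrite hE f'E fP.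
Qed.

Lemma dsum_is_dsum (I : Type) (M : lmodType R) : exists
  (inj : forall i : I, {linear M -> dsum I M}) (pr : forall i : I, {linear dsum I M -> M}),
  @is_dsum I (fun=> M) (dsum I M) inj pr.
Proof.
have dE (d e : dsum I M) : (forall i, d i = e i) -> d = e.
  by move=> de; apply: val_inj; apply: funext.
have mkd (f : I -> M) : finite_set [set i | f i <> 0] ->
    exists d : dsum I M, forall i, d i = f i.
  by move=> ff; have fs : f \in @fin_supp R I M by [exact/asboolP]; exists (DSum fs).
have DL a (x y : dsum I M) i : (a *: x + y : dsum I M) i = a *: x i + y i.
  by have := linearP (val : dsum I M -> (I -> M)) a x y => /(congr1 (fun f => f i)).
have prP i : exists h : {linear dsum I M -> M}, forall d, h d = d i.
  by apply: linear_ex => a x y; exact: DL.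
have inP i : exists h : {linear M -> dsum I M}, forall x,
    h x i = x /\ forall j, j <> i -> h x j = 0.
  have H (x : M) : exists d : dsum I M, d i = x /\ forall j, j <> i -> d j = 0.
    have [|d dx] := mkd (fun j => if pselect (j = i) then x else 0).
      by apply: (@sub_finite_set _ _ [set i]) => // j /=; case: pselect.
    by exists d; split=> [|j ji]; rewrite dx; case: pselect.
  have /choice[f fP] := H.
  have [|f' f'E] := @linear_ex R M (dsum I M) f.
    move=> a x y; apply: dE => j; rewrite DL.
    case: (pselect (j = i)) => [->|ji]; first by rewrite !(fP _).1.
    by rewrite !(fP _).2// scaler0 addr0.
  by exists f' => x; rewrite f'E.
exists (fun i => projT1 (cid (inP i))), (fun i => projT1 (cid (prP i))); split.
- move=> i x; case: (cid (prP i)) => q /= qE; case: (cid (inP i)) => h /= hP.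
  by rewrite qE (hP x).1.
- move=> i j x ij; case: (cid (prP i)) => q /= qE; case: (cid (inP j)) => h /= hP.
  by rewrite qE (hP x).2.
- move=> d d0; apply: dE => i; have := d0 i; case: (cid (prP i)) => q /= ->.
  by move=> ->.
- move=> d; rewrite (_ : [set _ | _] = [set i | d i <> 0]).
    by case: d => d /= /asboolP.
  by apply/seteqP; split=> i /=; case: (cid (prP i)) => q /= ->.
- move=> A g fg.
  have /choice[f fP] : forall a, exists d : dsum I M, forall i, d i = g i a.
    by move=> a; exact: mkd.
  have [|f' f'E] := @linear_ex R A (dsum I M) f.
    by move=> a x y; apply: dE => i; rewrite DL !fP linearP.
  by exists f' => i a; case: (cid (prP i)) => q /= ->; rewrite f'E fP.
Qed.

Lemma dsum_map (I : Type) (M N : I -> lmodType R) (D E : lmodType R)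
    (injD : forall i, {linear M i -> D}) (prD : forall i, {linear D -> M i})
    (injE : forall i, {linear N i -> E}) (prE : forall i, {linear E -> N i})
    (f : forall i, {linear M i -> N i}) :
  is_dsum injD prD -> is_dsum injE prE ->
  exists h : {linear D -> E}, [/\ forall i x, h (injD i x) = injE i (f i x) ,
    forall i d, prE i (h d) = f i (prD i d)
  & (forall i, injective (f i)) -> injective h].
Proof.
move=> dD dE; have [h hE] := dsum_out dD (fun i => injE i \o f i).
have hp i d : prE i (h d) = f i (prD i d).
  move: d; apply: (dsum_hom_eq dD (g := prE i \o h) (h := f i \o prD i)) => j x /=.
  rewrite hE /=; have [ij|ij] := pselect (i = j).
    by subst j; rewrite (dsum_prK dD) (dsum_prK dE).
  by rewrite (dsum_pr0 dD)// (dsum_pr0 dE)// linear0.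
exists h; split=> // fi; apply: inj0P => d d0; apply: (dsum_ext dD) => i.
by apply: (fi i); rewrite -hp d0 !linear0.
Qed.

End DirectSums.
(** * Short exact sequences, pushouts and colimits *)

Section ShortExact.
Variable R : pzRingType.
Implicit Types (A B C D H K L M N P Q T U V W X Y Z : lmodType R).

Definition ses A B C (f : {linear A -> B}) (g : {linear B -> C}) : Prop :=
  [/\ injective f, exact f g & surj g].

Lemma ses0 A B C (f : {linear A -> B}) (g : {linear B -> C}) x :
  ses f g -> g (f x) = 0.
Proof. by move=> [_ e _]; apply/e; exists x. Qed.

Lemma ses_ker B C (g : {linear B -> C}) :
  surj g -> exists A (f : {linear A -> B}), ses f g.
Proof.
move=> gs; have [A [f [fi fP]]] := submodule_ex (submodule_ker g).
by exists A, f; split.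
Qed.

Lemma ses_coker A B (f : {linear A -> B}) :
  injective f -> exists C (g : {linear B -> C}), ses f g.
Proof.
move=> fi; have [C [g [gs gP]]] := quotient_ex (submodule_range f).
by exists C, g; split.
Qed.

Lemma ses_in A B C X (f : {linear A -> B}) (g : {linear B -> C}) (h : {linear X -> B}) :
  ses f g -> (forall x, g (h x) = 0) -> exists k : {linear X -> A}, forall x, f (k x) = h x.
Proof. by move=> [fi e _] gh; apply: factor_inj => // x; apply/e. Qed.

Lemma ses_out A B C X (f : {linear A -> B}) (g : {linear B -> C}) (h : {linear B -> X}) :
  ses f g -> (forall x, h (f x) = 0) -> exists k : {linear C -> X}, forall x, k (g x) = h x.
Proof. by move=> [_ e gs] hf; apply: factor_surj => // b /e[x <-]. Qed.

Lemma surj_lin_eq B C X (g : {linear B -> C}) (h k : C -> X) :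
  surj g -> (forall b, h (g b) = k (g b)) -> forall c, h c = k c.
Proof. by move=> gs e c; have [b <-] := gs c. Qed.

Lemma lin_sub A B (f g : {linear A -> B}) :
  exists h : {linear A -> B}, forall x, h x = f x - g x.
Proof.
by apply: linear_ex => a x y; rewrite !linearP addrACA -scalerDr.
Qed.

Lemma lin_pair A B C (f : {linear A -> B}) (g : {linear A -> C}) :
  exists h : {linear A -> (B * C)%type}, forall x, h x = (f x, g x).
Proof. by apply: linear_ex => a x y; rewrite !linearP. Qed.

Lemma lin_copair A B C (f : {linear A -> C}) (g : {linear B -> C}) :
  exists h : {linear (A * B)%type -> C}, forall x, h x = f x.1 + g x.2.
Proof.
by apply: linear_ex => a x y; rewrite !linearP addrACA -scalerDr.
Qed.

Lemma lin_fst A B : exists h : {linear (A * B)%type -> A}, forall x, h x = x.1.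
Proof. exact: linear_ex. Qed.

Lemma lin_snd A B : exists h : {linear (A * B)%type -> B}, forall x, h x = x.2.
Proof. exact: linear_ex. Qed.

Lemma lin_inl A B : exists h : {linear A -> (A * B)%type}, forall x, h x = (x, 0).
Proof. by apply: linear_ex => a x y; congr pair; rewrite /= scaler0 addr0. Qed.

Lemma lin_inr A B : exists h : {linear B -> (A * B)%type}, forall x, h x = (0, x).
Proof. by apply: linear_ex => a x y; congr pair; rewrite /= scaler0 addr0. Qed.

Lemma lin_zero A B : exists h : {linear A -> B}, forall x, h x = 0.
Proof. by apply: linear_ex => a x y; rewrite scaler0 addr0. Qed.

Lemma lin_id A : exists h : {linear A -> A}, forall x, h x = x.
Proof. exact: linear_ex. Qed.

Lemma ses_prod A B : exists (f : {linear A -> (A * B)%type}) (g : {linear (A * B)%type -> B}),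
  [/\ ses f g, forall x, f x = (x, 0) & forall x, g x = x.2].
Proof.
have [f fE] := lin_inl A B; have [g gE] := lin_snd A B.
exists f, g; split=> //; split=> [x y|[x y]|y].
- by rewrite !fE => -[].
- rewrite gE /=; split=> [->|[z]]; first by exists x.
  by rewrite fE => -[].
- by exists (0, y); rewrite gE.
Qed.

(** The universal property yields maps out; [pushout_gen] and [pushout_eq], which says that all
    identifications come from [K], allow chases with elements. *)
Record is_pushout K A H D (i : {linear K -> A}) (f : {linear K -> H})
    (a : {linear A -> D}) (h : {linear H -> D}) : Prop := IsPushout {
  pushout_comm : forall x, a (i x) = h (f x);
  pushout_gen : forall d, exists x y, d = a x + h y;
  pushout_eq : forall x y, a x = h y -> exists k, i k = x /\ f k = y;
  pushout_out : forall Y (u : {linear A -> Y}) (v : {linear H -> Y}),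
    (forall k, u (i k) = v (f k)) ->
    exists w : {linear D -> Y}, (forall x, w (a x) = u x) /\ (forall y, w (h y) = v y) }.

Lemma pushout_ex K A H (i : {linear K -> A}) (f : {linear K -> H}) :
  exists D (a : {linear A -> D}) (h : {linear H -> D}), is_pushout i f a h.
Proof.
have [|j jE] := @linear_ex R K (A * H)%type (fun k => (i k, - f k)).
  by move=> a x y; congr pair; rewrite /= !linearP.
have [D [p [ps pP]]] := quotient_ex (submodule_range j).
have [il ilE] := lin_inl A H; have [ir irE] := lin_inr A H.
exists D, (p \o il), (p \o ir); split=> /=.
- move=> k; apply/subr0_eq; rewrite -linearB; apply/pP; exists k.
  by rewrite jE ilE irE; congr pair; rewrite /= ?subr0 ?sub0r.
- move=> d; have [[x y] <-] := ps d; exists x, y; rewrite -linearD; congr (p _).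
  by rewrite ilE irE; congr pair; rewrite /= ?addr0 ?add0r.
- move=> x y /(congr1 (fun d => d - p (ir y))); rewrite subrr -linearB => /pP[k].
  rewrite jE ilE irE => -[ix fy]; exists k; split; first by rewrite ix subr0.
  by apply: oppr_inj; rewrite fy sub0r.
- move=> Y u v uv; have [w wE] := lin_copair u v.
  have [|w' w'E] := factor_surj (g := w) ps.
    by move=> _ /pP[k <-]; rewrite jE wE /= linearN uv subrr.
  exists w'; split=> x; rewrite w'E wE ?ilE ?irE /=.
    by rewrite linear0 addr0.
  by rewrite linear0 add0r.
Qed.

Section Pushout.
Variables (K A H D : lmodType R) (i : {linear K -> A}) (f : {linear K -> H}).
Variables (a : {linear A -> D}) (h : {linear H -> D}).
Hypothesis pD : is_pushout i f a h.

Lemma pushout_inj : injective i -> injective h.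
Proof.
move=> ii; apply: inj0P => y y0.
have [k [ik <-]] : exists k, i k = 0 /\ f k = y by apply: (pushout_eq pD); rewrite y0 linear0.
by rewrite (ii k 0) ?linear0.
Qed.

Lemma pushout_sym : is_pushout f i h a.
Proof.
split=> [x|d|x y e|Y u v uv].
- by rewrite (pushout_comm pD).
- by have [x [y ->]] := pushout_gen pD d; exists y, x; rewrite addrC.
- by have [k [? ?]] := pushout_eq pD (esym e); exists k.
- have [|w [wa wh]] := pushout_out pD (u := v) (v := u); first by move=> k; rewrite uv.
  by exists w.
Qed.

Lemma pushout_ses M (p : {linear A -> M}) : ses i p ->
  exists q : {linear D -> M}, ses h q /\ forall x, q (a x) = p x.
Proof.
move=> ip; have [z zE] := lin_zero H M.
have [|q [qa qh]] := pushout_out pD (u := p) (v := z).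
  by move=> k; rewrite zE (ses0 _ ip).
have [ii ie ps] := ip.
exists q; split=> //; split; first exact: pushout_inj.
  move=> d; split=> [|[y <-]]; last by rewrite qh zE.
  have [x [y ->]] := pushout_gen pD d; rewrite linearD qa qh zE addr0 => /ie[k <-].
  by exists (f k + y); rewrite linearD (pushout_comm pD).
by move=> m; have [x <-] := ps m; exists (a x).
Qed.

End Pushout.

Lemma proj_lift P M N (p : {linear M -> N}) (f : {linear P -> N}) :
  projective P -> surj p -> exists h : {linear P -> M}, forall x, p (h x) = f x.
Proof. by move=> pP; exact: pP. Qed.

Lemma projective_dsum (I : Type) (M : I -> lmodType R) D
    (inj : forall i, {linear M i -> D}) (pr : forall i, {linear D -> M i}) :
  is_dsum inj pr -> (forall i, projective (M i)) -> projective D.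
Proof.
move=> dD pM A B p f ps.
have H i : exists h : {linear M i -> A}, forall x, p (h x) = (f \o inj i) x by exact: pM.
have [h hE] := dsum_out dD (fun i => projT1 (cid (H i))).
exists h; apply: (dsum_hom_eq dD (g := p \o h)) => i x /=.
by rewrite hE; case: (cid (H i)) => /= g ->.
Qed.

Lemma lin_elt M (m : M) : exists h : {linear R^o -> M}, forall r : R, h r = r *: m.
Proof. by apply: linear_ex => a x y; rewrite scalerDl scalerA. Qed.

Lemma projective_ring : projective (R^o : lmodType R).
Proof.
move=> A B p f ps; have [m mE] := ps (f 1); have [h hE] := lin_elt m.
exists h => r; rewrite hE linearZ /= mE -linearZ /=; congr (f _).
by rewrite -[LHS]/(r * 1) mulr1.
Qed.

Lemma free_ex M : exists P (p : {linear P -> M}), projective P /\ surj p.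
Proof.
have [D [inj [pr dD]]] := is_dsum_ex (fun _ : M => R^o : lmodType R).
have H (m : M) : exists h : {linear R^o -> M}, forall r : R, h r = r *: m := lin_elt m.
have [h hE] := dsum_out dD (fun m => projT1 (cid (H m))).
exists D, h; split; first by apply: (projective_dsum dD) => i; exact: projective_ring.
move=> m; exists (inj m 1); rewrite hE; case: (cid _) => /= g ->.
by rewrite scale1r.
Qed.

Lemma presentation_ex M : exists K P (i : {linear K -> P}) (p : {linear P -> M}),
  projective P /\ ses i p.
Proof.
have [P [p [pP ps]]] := free_ex M; have [K [i ip]] := ses_ker ps.
by exists K, P, i, p.
Qed.

Record is_colimit (M : nat -> lmodType R) (j : forall k, {linear M k -> M k.+1})
    L (c : forall k, {linear M k -> L}) : Prop := IsColimit {
  colim_comm : forall k x, c k.+1 (j k x) = c k x;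
  colim_gen : forall y, exists k x, y = c k x;
  colim_inj : (forall k, injective (j k)) -> forall k, injective (c k);
  colim_out : forall Y (g : forall k, {linear M k -> Y}),
    (forall k x, g k.+1 (j k x) = g k x) ->
    exists h : {linear L -> Y}, forall k x, h (c k x) = g k x }.

(* The colimit is the cokernel of 1 - shift on the direct sum; injectivity of the
   structure maps is read off componentwise, using finite supports. *)
Lemma colimit_ex (M : nat -> lmodType R) (j : forall k, {linear M k -> M k.+1}) :
  exists L (c : forall k, {linear M k -> L}), is_colimit j c.
Proof.
have [D [inj [pr dD]]] := is_dsum_ex M.
have H k : exists h : {linear M k -> D}, forall x, h x = inj k x - inj k.+1 (j k x).
  exact: (lin_sub (inj k) (inj k.+1 \o j k)).
have [s sE'] := dsum_out dD (fun k => projT1 (cid (H k))).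
have sE k x : s (inj k x) = inj k x - inj k.+1 (j k x).
  by rewrite sE'; case: (cid _).
have s0 d : pr 0%N (s d) = pr 0%N d.
  move: d; apply: (dsum_hom_eq dD (g := pr 0%N \o s)) => k x /=.
  by rewrite sE linearB (dsum_pr0 dD (i := 0%N) (j := k.+1)) ?subr0.
have sS k d : pr k.+1 (s d) = pr k.+1 d - j k (pr k d).
  have [g gE] := lin_sub (pr k.+1) (j k \o pr k); rewrite -[RHS]gE.
  move: d; apply: (dsum_hom_eq dD (g := pr k.+1 \o s)) => l x /=.
  rewrite gE sE linearB /=; congr (_ - _).
  have [kl|kl] := pselect (k = l); first by subst l; rewrite !(dsum_prK dD).
  rewrite (dsum_pr0 dD (i := k) (j := l))// (dsum_pr0 dD) ?linear0//.
  by move=> [].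
have [L [p [ps pP]]] := quotient_ex (submodule_range s).
have cc k x : p (inj k.+1 (j k x)) = p (inj k x).
  apply/esym/subr0_eq; rewrite -linearB; apply/pP; exists (inj k x).
  by rewrite sE.
have shift k (x : M k) l : exists y, p (inj (l + k)%N y) = p (inj k x).
  elim: l => [|l [y yE]]; first by exists x.
  by exists (j _ y); rewrite -[(l.+1 + k)%N]/(l + k).+1 cc.
have push k m : (k <= m)%N -> forall x, exists y, p (inj m y) = p (inj k x).
  by move=> km x; have := shift k x (m - k)%N; rewrite subnK.
exists L, (fun k => p \o inj k); split=> //=.
- move=> z; have [d <-] := ps z; move: d; apply: (dsum_gen dD); last first.
    by move=> k x; exists k, x.
  split=> [|a d e [k [x dx]] [l [y ey]]]; first by exists 0%N, 0; rewrite !linear0.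
  have [x' x'E] := push k (maxn k l) (leq_maxl _ _) x.
  have [y' y'E] := push l (maxn k l) (leq_maxr _ _) y.
  by exists (maxn k l), (a *: x' + y'); rewrite !linearP /= dx ey x'E y'E.
- move=> ji k; apply: inj0P => x /= /pP[d sd].
  (* The components of [d] are zero below [k], equal to [x] at [k], and from there on each is the
     image of the preceding one under an injection. A component beyond the finite support vanishes,
     hence so does [x]. *)
  have lt m : (m < k)%N -> pr m d = 0.
    elim: m => [|m IH] mk.
      by rewrite -s0 sd (dsum_pr0 dD)// => e; rewrite e ltnn in mk.
    have := sS m d; rewrite sd (dsum_pr0 dD); last by move=> e; rewrite e ltnn in mk.
    by rewrite (IH (ltnW mk)) linear0 subr0 => <-.
  have dk : pr k d = x.
    case: k x sd lt => [|k] x sd lt; first by rewrite -s0 sd (dsum_prK dD).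
    by have := sS k d; rewrite sd (dsum_prK dD) (lt k (ltnSn k)) linear0 subr0 => <-.
  have ge m : pr (m + k)%N d = 0 -> x = 0.
    elim: m => [|m IH]; first by rewrite add0n dk.
    rewrite -[(m.+1 + k)%N]/(m + k).+1 => d0; apply: IH.
    have := sS (m + k)%N d; rewrite sd (dsum_pr0 dD) ?d0 ?sub0r; last first.
      by move=> e; have := leq_addl m k; rewrite -ltnS e ltnn.
    by move=> /esym/eqP; rewrite oppr_eq0 => /eqP d0'; apply: (ji _); rewrite d0' linear0.
  have /finite_seqP[t tE] := dsum_fin dD d.
  pose m := (\max_(q <- t) q).+1.
  apply: (ge m); apply: contrapT => dm.
  have : ([set` t] : set nat) (m + k)%N by rewrite -tE.
  move=> /= mt; have : (m + k <= \max_(q <- t) q)%N by apply: (@leq_bigmax_seq _ t xpredT id).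
  by rewrite /m addSn ltnNge leq_addr.
- move=> Y g gE; have [h hE] := dsum_out dD g.
  have [d /pP[e <-]|w wE] := factor_surj (g := h) ps.
    have [z zE] := lin_zero D Y; rewrite -(zE e).
    move: e; apply: (dsum_hom_eq dD (g := h \o s)) => k x /=.
    by rewrite sE linearB !hE gE subrr zE.
  by exists w => k x; rewrite wE hE.
Qed.

End ShortExact.
(** * Injective modules and Ext^1 *)

Section Injectives.
Variable R : pzRingType.
Implicit Types (A B C D E H I J K L M N P Q T U V W X Y Z : lmodType R).

Definition injmod I : Prop := forall A B (i : {linear A -> B}) (f : {linear A -> I}),
  injective i -> exists h : {linear B -> I}, forall x, h (i x) = f x.

(** Two points of the union of a chain lie in a common member; this gives closure under linear
    combinations in Zorn's lemma. *)
Lemma total_on_pair (T : Type) (F : set (set T)) (G0 : set T) u v :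
  total_on F subset -> (\bigcup_(X in F) X `|` G0) u -> (\bigcup_(X in F) X `|` G0) v ->
  (G0 u /\ G0 v) \/ exists2 X, F X & (X `|` G0) u /\ (X `|` G0) v.
Proof.
move=> tF [[X FX Xu]|u0] [[Y FY Yv]|v0]; last by left.
- right; have [XY|YX] := tF X Y FX FY.
    by exists Y => //; split; left => //; exact: XY.
  by exists X => //; split; left => //; exact: YX.
- by right; exists X => //; split; [left|right].
- by right; exists Y => //; split; [right|left].
Qed.

(* Zorn's lemma is applied to graphs of partial extensions; G0, the graph of [f],
   is joined to every set so that the empty chain causes no trouble. *)
Lemma baer I :
  (forall J (i : {linear J -> R^o}) (f : {linear J -> I}), injective i ->
    exists h : {linear R^o -> I}, forall x, h (i x) = f x) -> injmod I.
Proof.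
move=> bI A B i f ii.
pose G0 : set (B * I) := fun u => exists a, u = (i a, f a).
pose P0 (G : set (B * I)) := submodule (M := (B * I)%type) G /\ forall n, G (0, n) -> n = 0.
have P00 : P0 G0.
  split; [split|].
  - by exists 0; rewrite !linear0.
  - by move=> a _ _ [x ->] [y ->]; exists (a *: x + y); rewrite !linearP.
  - move=> n [a [/esym ia ->]].
    by rewrite (ii a 0) ?linear0.
have [|G [PG Gmax]] := @Zorn_bigcup (B * I) (fun G => P0 (G `|` G0)).
  move=> F FP tF; split; [split|].
  - by right; exact: P00.1.1.
  - move=> a u v Fu Fv; have [[u0 v0]|[X FX [Xu Xv]]] := total_on_pair tF Fu Fv.
      by right; exact: P00.1.2.
    have [Xau|?] := (FP X FX).1.2 a u v Xu Xv; last by right.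
    by left; exists X.
  - move=> n [[X FX Xn]|]; last exact: P00.2.
    by apply: (FP X FX).2; left.
pose H := G `|` G0; have [sH H0] : P0 H := PG.
have Hmax (G' : set (B * I)) : P0 G' -> H `<=` G' -> G' `<=` H.
  move=> PG' HG'; have G0G' : G0 `<=` G' by move=> u u0; apply: HG'; right.
  suff -> : G' = G by move=> u; left.
  apply: contrapT => ne; apply: (Gmax G').
    rewrite properEneq; split; last by move=> u Gu; apply: HG'; left.
    by apply/eqP => e; apply: ne.
  by rewrite (_ : _ `|` _ = G')//; apply/seteqP; split=> u; [case=> //; exact: G0G'|left].
have Hfun b n n' : H (b, n) -> H (b, n') -> n = n'.
  move=> h h'; apply/subr0_eq/H0.
  by have := submoduleB sH h h'; rewrite (_ : _ - _ = (0, n - n'))//; congr pair; exact: subrr.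
suff tot b : exists n, H (b, n).
  have /choice[h hP] := tot.
  have [|h' h'E] := @linear_ex R B I h.
    move=> a x y; apply: (Hfun (a *: x + y)); first exact: hP.
    exact: (sH.2 a (x, h x) (y, h y)).
  by exists h' => x; rewrite h'E; apply: (Hfun (i x)) => //; right; exists x.
have [rb rbE] := lin_elt b.
(* The left ideal of all r such that r b lies in the domain of the maximal extension; the hypothesis
   is applied to it. *)
have sJ : submodule (fun r : R^o => exists n, H (rb r, n)).
  split; first by exists 0; rewrite linear0; exact: sH.1.
  move=> a r s [n hn] [m hm]; exists (a *: n + m); rewrite linearP.
  exact: (sH.2 a (rb r, n) (rb s, m)).
have [J [j [ji jP]]] := submodule_ex sJ.
have /choice[g gP] : forall x : J, exists n, H (rb (j x), n).
  by move=> x; apply/jP; exists x.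
have [|g' g'E] := @linear_ex R J I g.
  move=> a x y; apply: (Hfun (rb (j (a *: x + y)))); first exact: gP.
  by rewrite !linearP; exact: (sH.2 a (rb (j x), g x) (rb (j y), g y)).
have [h hE] := bI J j g' ji.
(* The sum of [H] and the pairs (r b, h r). It is still a graph because [h] agrees with the maximal
   extension on the ideal. *)
pose G' : set (B * I) := fun u => exists r : R^o, H (u.1 - rb r, u.2 - h r).
have HG' : H `<=` G' by move=> [x n] Hu; exists 0; rewrite /= !linear0 !addr0.
exists (h 1); apply: (Hmax G' _ HG'); last first.
  by exists 1; rewrite /= rbE scale1r !subrr; exact: sH.1.
split; [split|].
- by apply: HG'; exact: sH.1.
- move=> a [x n] [y m] [r Hr] [s Hs]; exists (a *: r + s).
  have := sH.2 a _ _ Hr Hs; congr H; congr pair => /=;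
    by rewrite linearP scalerBr opprD addrACA.
- move=> n [r /=]; rewrite sub0r => Hr.
  have Hr' : H (rb r, h r - n).
    by have := submoduleN sH Hr; congr H; congr pair; rewrite /= ?opprK ?opprB.
  have [x jx] : exists x, j x = r by apply/jP; exists (h r - n).
  move: Hr'; rewrite -jx hE g'E => /Hfun -/(_ _ (gP x)) /eqP.
  by rewrite -subr_eq0 addrAC subrr sub0r oppr_eq0 => /eqP.
Qed.

End Injectives.

(** * Vanishing of Ext^1 through presentations and copresentations *)

Section Ext1.
Variable R : pzRingType.
Implicit Types (A B C D E H I J K L M N P Q T U V W X Y Z : lmodType R).

(* Ext^1(M, N) = 0: the connecting map out of Hom(M, C) vanishes. *)
Definition ext1 M N : Prop := forall B C (j : {linear N -> B}) (q : {linear B -> C}),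
  ses j q -> forall f : {linear M -> C}, exists h : {linear M -> B}, forall x, q (h x) = f x.

(** Lift [f \o p] to [B]; on [K] the lift lands in [N]. Extending that restriction to [P] and
    subtracting it makes the lift factor through [M]. Many later chases repeat this pattern of
    lifting, correcting and factoring. *)
Lemma ext1_pres K P M N (i : {linear K -> P}) (p : {linear P -> M}) :
  ses i p -> projective P ->
  (forall f : {linear K -> N}, exists g : {linear P -> N}, forall x, g (i x) = f x) ->
  ext1 M N.
Proof.
move=> ip pP ext B C j q jq f; have [_ _ qs] := jq.
have [h hE] := proj_lift (f \o p) pP qs.
have [|k kE] := ses_in (h := h \o i) jq.
  by move=> x; rewrite /= hE /= (ses0 _ ip) linear0.
have [g gE] := ext k; have [d dE] := lin_sub h (j \o g).
have [|l lE] := ses_out (h := d) ip.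
  by move=> x; rewrite dE /= gE kE subrr.
have [_ _ ps] := ip.
exists l; apply: (surj_lin_eq (h := q \o l) (k := f) ps) => x /=.
by rewrite lE dE linearB hE (ses0 _ jq) subr0.
Qed.

(** The pushout along [f] is an extension of [M] by [N]; a section of it gives a retraction onto
    [N], whose composite with the map from [B] extends [f]. *)
Lemma ext1_extend A B M N (i : {linear A -> B}) (p : {linear B -> M}) :
  ses i p -> ext1 M N -> forall f : {linear A -> N},
  exists g : {linear B -> N}, forall x, g (i x) = f x.
Proof.
move=> ip e f; have [D [a [h pD]]] := pushout_ex i f.
have [q [hq qa]] := pushout_ses pD ip; have [hi _ _] := hq.
have [idM idE] := lin_id M; have [s sE] := e _ _ _ _ hq idM.
have [idD idDE] := lin_id D; have [r rE] := lin_sub idD (s \o q).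
have [|k kE] := ses_in (h := r) hq.
  by move=> d; rewrite rE linearB /= idDE sE idE subrr.
exists (k \o a) => x; apply: hi.
by rewrite /= kE (pushout_comm pD) rE idDE /= (ses0 _ hq) linear0 subr0.
Qed.

Lemma ext1_proj P N : projective P -> ext1 P N.
Proof. by move=> pP B C j q [_ _ qs] f; exact: pP. Qed.

(** Dual to [ext1_pres]: lifting along one embedding of [N] into an injective module suffices. *)
Lemma ext1_copres N I C M (j : {linear N -> I}) (q : {linear I -> C}) :
  ses j q -> injmod I ->
  (forall f : {linear M -> C}, exists h : {linear M -> I}, forall x, q (h x) = f x) ->
  ext1 M N.
Proof.
move=> jq iI lft; have [K [P [i [p [pP ip]]]]] := presentation_ex M.
apply: (ext1_pres ip pP) => f; have [ii _ ps] := ip; have [ji _ _] := jq.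
have [e eE] := iI _ _ i (j \o f) ii.
have [|g gE] := ses_out (h := q \o e) ip.
  by move=> x; rewrite /= eE /= (ses0 _ jq).
have [l lE] := lft g; have [d dE] := lin_sub e (l \o p).
have [|k kE] := ses_in (h := d) jq.
  by move=> x; rewrite dE linearB /= lE gE subrr.
exists k => x; apply: ji; rewrite kE dE eE /= (ses0 _ ip) linear0 subr0 //.
Qed.

End Ext1.
(** * Noetherian modules and the small object argument *)

Section Finiteness.
Variable R : pzRingType.
Implicit Types (A B C D E F G H I J K L M N P Q T U V W X Y Z : lmodType R).

(** Finite generation as an induction principle: a property defining a submodule is checked on the
    generators, without writing linear combinations. [noeth] has the same form for every
    submodule. *)
Definition fgens M : Prop := exists s : seq M, forall K : set M,
  submodule K -> (forall x, x \in s -> K x) -> forall x, K x.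

Definition noeth M : Prop := forall K : set M, submodule K -> exists s : seq M,
  (forall x, x \in s -> K x) /\
  forall L : set M, submodule L -> (forall x, x \in s -> L x) -> forall x, K x -> L x.

Definition freen n : lmodType R := ('I_n -> R^o).

Lemma lin_freen n M (v : 'I_n -> M) :
  exists h : {linear freen n -> M}, forall x, h x = \sum_(k < n) (x k : R) *: v k.
Proof.
apply: linear_ex => a x y; rewrite scaler_sumr -big_split; apply: eq_bigr => k _ /=.
by rewrite scalerA -scalerDl.
Qed.

Definition unit_vec n (k : 'I_n) : freen n := fun l => (k == l)%:R.

Lemma freen_gen n (x : freen n) : x = \sum_(k < n) (x k : R) *: unit_vec k.
Proof.
apply: funext => l; rewrite (_ : (\sum_k _) l = \sum_k ((x k : R) *: unit_vec k : freen n) l).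
  rewrite (bigD1 l) //= big1 ?addr0 => [|k /negbTE kl].
    by rewrite -[RHS]/(x l * (l == l)%:R) eqxx mulr1.
  by rewrite -[LHS]/(x k * (k == l)%:R) kl mulr0.
by elim/big_rec2: _ => // k u v _ <-.
Qed.

Lemma projective_freen n : projective (freen n).
Proof.
move=> A B p f /choice[s sP].
have [h hE] := lin_freen (fun k => s (f (unit_vec k))).
exists h => x; rewrite hE [in RHS](freen_gen x) !linear_sum.
by apply: eq_bigr => k _; rewrite !linearZ /= sP.
Qed.

Lemma finitely_generatedP M : finitely_generated M <-> fgens M.
Proof.
split=> [[n [v vP]]|[s sP]].
  exists [seq v k | k <- enum 'I_n] => K sK Kv x; have [c ->] := vP x.
  apply: submodule_sum => // k; apply: submoduleZ => //; apply: Kv.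
  by apply: map_f; rewrite mem_enum.
exists (size s), (fun k => nth 0 s k) => x.
have [h hE] := lin_freen (fun k : 'I_(size s) => nth 0 s k).
suff [y <-] : exists y, h y = x by exists y; rewrite hE.
apply: (sP _ (submodule_range h)) => y ys.
have ly : (index y s < size s)%N by rewrite index_mem.
exists (unit_vec (Ordinal ly)); rewrite hE (bigD1 (Ordinal ly))//= big1 ?addr0.
  by rewrite /unit_vec eqxx nth_index// scale1r.
by move=> k /negbTE kl; rewrite /unit_vec eq_sym kl; exact: scale0r.
Qed.

Lemma fgens_cover M : fgens M -> exists n (p : {linear freen n -> M}), surj p.
Proof.
move=> /finitely_generatedP[n [v vP]]; have [h hE] := lin_freen v.
by exists n, h => x; have [c ->] := vP x; exists c; rewrite hE.
Qed.

Lemma fgens_surj A B (f : {linear A -> B}) : surj f -> fgens A -> fgens B.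
Proof.
move=> fs [s sP]; exists [seq f x | x <- s] => K sK Ks y; have [x <-] := fs y.
apply: (sP _ (submodule_preim f sK)) => z zs; apply: Ks; exact: map_f.
Qed.

Lemma fgens_ses A B C (f : {linear A -> B}) (g : {linear B -> C}) :
  ses f g -> fgens A -> fgens C -> fgens B.
Proof.
move=> [_ e gs] [s sP] [t tP]; have [l lP] := choice gs.
exists ([seq f x | x <- s] ++ [seq l y | y <- t]) => K sK Kst b.
have Kf a : K (f a).
  apply: (sP _ (submodule_preim f sK)) => z zs; apply: Kst.
  by rewrite mem_cat map_f.
have [k Kk gk] : exists2 k, K k & g k = g b.
  apply: (tP _ (submodule_im g sK)) => y yt; exists (l y); last exact: lP.
  by apply: Kst; rewrite mem_cat map_f ?orbT.
have /e[a fa] : g (b - k) = 0 by rewrite linearB gk subrr.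
by rewrite -(subrK k b) -fa; apply: submoduleD.
Qed.

Lemma fgens_freen n : fgens (freen n).
Proof.
exists [seq unit_vec k | k <- enum 'I_n] => K sK Ks x; rewrite (freen_gen x).
apply: submodule_sum => // k; apply: submoduleZ => //; apply: Ks.
by apply: map_f; rewrite mem_enum.
Qed.

Lemma fgens_ring : fgens (R^o : lmodType R).
Proof.
exists [:: 1 : R^o] => K sK K1 x; rewrite (_ : x = (x : R) *: (1 : R^o)).
  by apply: submoduleZ => //; apply: K1; rewrite inE.
by rewrite -[RHS]/(x * 1) mulr1.
Qed.

Lemma noeth_ses A B C (f : {linear A -> B}) (g : {linear B -> C}) :
  ses f g -> noeth A -> noeth C -> noeth B.
Proof.
move=> [_ e gs] nA nC K sK.
have [s [sK' sP]] := nA _ (submodule_preim f sK).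
have [t [tK' tP]] := nC _ (submodule_im g sK).
have /choice[l lP] : forall y, exists b, y \in t -> K b /\ g b = y.
  move=> y; have [/tK'[x Kx gx]|nt] := boolP (y \in t); first by exists x.
  by exists 0.
exists ([seq f x | x <- s] ++ [seq l y | y <- t]); split.
  move=> x; rewrite mem_cat => /orP[] /mapP[y ys ->]; first exact: sK'.
  exact: (lP y ys).1.
move=> L sL Lst b Kb.
(* The preimage is taken in [L] and [K] at once, so that b - k stays in [K] and the generators of
   the preimage of [K] in [A] apply to it. *)
have [k [Lk Kk] gk] : exists2 k, L k /\ K k & g k = g b.
  have sKL : submodule (fun x => L x /\ K x).
    split; first by split; [exact: sL.1|exact: sK.1].
    by move=> a x y [Lx Kx] [Ly Ky]; split; [exact: sL.2|exact: sK.2].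
  apply: (tP _ (submodule_im g sKL)); last by exists b.
  move=> y yt; have [Kly gly] := lP y yt; exists (l y) => //; split=> //.
  by apply: Lst; rewrite mem_cat map_f ?orbT.
have /e[a fa] : g (b - k) = 0 by rewrite linearB gk subrr.
rewrite -(subrK k b) -fa; apply: submoduleD => //.
apply: (sP _ (submodule_preim f sL)); last by rewrite fa; exact: submoduleB.
by move=> z zs; apply: Lst; rewrite mem_cat map_f.
Qed.

Lemma noeth_surj B C (g : {linear B -> C}) : surj g -> noeth B -> noeth C.
Proof.
move=> gs nB K sK; have [s [sKs sP]] := nB _ (submodule_preim g sK).
exists [seq g x | x <- s]; split=> [y /mapP[x /sKs Kx ->] //|L sL Ls y].
have [x <-] := gs y; apply: (sP _ (submodule_preim g sL)) => z zs.
by apply: Ls; exact: map_f.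
Qed.

Lemma noeth_sub_fgens A B (f : {linear A -> B}) : injective f -> noeth B -> fgens A.
Proof.
move=> fi nB; have [s [sr sP]] := nB _ (submodule_range f).
have /choice[l lP] : forall y, exists a, y \in s -> f a = y.
  move=> y; have [/sr[x fx]|ns] := boolP (y \in s); first by exists x.
  by exists 0.
exists [seq l y | y <- s] => K sK Kl a.
have [k Kk /fi <- //] : exists2 k, K k & f k = f a.
apply: (sP _ (submodule_im f sK)); last by exists a.
by move=> y ys; exists (l y); [apply: Kl; exact: map_f|exact: lP].
Qed.

Lemma noeth_ring : left_noetherian R -> noeth R^o.
Proof.
move=> nR K sK; have [|n [a [aK aP]]] := nR (fun x => `[< K x >]).
  split=> [|c x y /asboolP Kx /asboolP Ky]; apply/asboolP; [exact: sK.1|exact: sK.2].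
exists [seq a k | k <- enum 'I_n]; split=> [x /mapP[k _ ->]|L sL La x Kx].
  exact/asboolP/aK.
have [|c ->] := aP x; first exact/asboolP.
apply: submodule_sum => // k; apply: submoduleZ => //; apply: La.
by apply: map_f; rewrite mem_enum.
Qed.

Hypothesis nR : left_noetherian R.

Lemma noeth_fgens M : fgens M -> noeth M.
Proof.
move=> [s sP].
(* [F] is an iterated product, one factor R for each generator, so that each step is an instance of
   [noeth_ses]. *)
suff [F [p [nF sF]]] : exists (F : lmodType R) (p : {linear F -> M}),
    noeth F /\ forall x, x \in s -> exists y, p y = x.
  by apply: (noeth_surj _ nF) => x; exact: (sP _ (submodule_range p)).
elim: s {sP} => [|x s [F [p [nF sF]]]].
  have [z zE] := lin_zero (freen 0) M; exists (freen 0), z; split=> // K sK.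
  exists [::]; split=> // L sL _ x _.
  by rewrite (_ : x = 0); [exact: sL.1|apply: funext => -[]].
have [h hE] := lin_elt x; have [q qE] := lin_copair p h.
have [f [g [fg _ _]]] := ses_prod F (R^o : lmodType R).
exists (F * R^o)%type, q; split; first exact: (noeth_ses fg nF (noeth_ring nR)).
move=> y; rewrite inE => /orP[/eqP ->|/sF[z <-]].
  by exists (0, 1); rewrite qE /= linear0 hE scale1r add0r.
by exists (z, 0); rewrite qE /= linear0 addr0.
Qed.

Lemma fgens_presentation M : fgens M -> exists K n (i : {linear K -> freen n})
  (p : {linear freen n -> M}), ses i p /\ fgens K.
Proof.
move=> /fgens_cover[n [p ps]]; have [K [i ip]] := ses_ker ps; exists K, n, i, p.
split=> //; have [ii _ _] := ip; apply: (noeth_sub_fgens ii); apply: noeth_fgens.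
exact: fgens_freen.
Qed.

(** Smallness of finitely generated modules: the images of the generators lie in a common stage, and
    since that stage embeds in [L] the whole map factors through it. *)
Lemma fgens_colimit (M : nat -> lmodType R) (j : forall k, {linear M k -> M k.+1}) L
    (c : forall k, {linear M k -> L}) K (g : {linear K -> L}) :
  is_colimit j c -> (forall k, injective (j k)) -> fgens K ->
  exists k (h : {linear K -> M k}), forall x, c k (h x) = g x.
Proof.
move=> cL ji [s sP].
have up k l y : exists z, c (l + k)%N z = c k y.
  elim: l => [|l [z zE]]; first by exists y.
  by exists (j _ z); rewrite -[(l.+1 + k)%N]/(l + k).+1 (colim_comm cL).
suff [k kP] : exists k, forall x, x \in s -> exists y, c k y = g x.
  exists k; apply: factor_inj; first exact: (colim_inj cL).
  apply: (sP (fun x => exists y, c k y = g x)) => //.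
  exact: (submodule_preim g (submodule_range (c k))).
elim: s {sP} => [|x s [k kP]]; first by exists 0%N.
have [l [y xE]] := colim_gen cL (g x); exists (k + l)%N => z.
rewrite inE => /orP[/eqP ->|/kP[w <-]].
  by rewrite xE; exact: up.
by rewrite addnC; exact: up.
Qed.

End Finiteness.

(** * The small object argument in countably many steps *)

Section SmallObject.
Variables (R : pzRingType) (S : Type) (K P : S -> lmodType R).
Variable i : forall s, {linear K s -> P s}.
Hypotheses (i_inj : forall s, injective (i s)) (P_proj : forall s, projective (P s)).
Implicit Types (L N Y Z : lmodType R).

Definition extends Y : Prop := forall s (g : {linear K s -> Y}),
  exists e : {linear P s -> Y}, forall x, e (i s x) = g x.

(* The left lifting property against the epimorphisms with kernel in [extends]. *)
Definition lifting N L (c : {linear N -> L}) : Prop :=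
  forall Y0 Y Z (j : {linear Y0 -> Y}) (q : {linear Y -> Z}), ses j q -> extends Y0 ->
  forall (f : {linear L -> Z}) (g : {linear N -> Y}), (forall x, q (g x) = f (c x)) ->
  exists h : {linear L -> Y}, (forall x, h (c x) = g x) /\ (forall x, q (h x) = f x).

(** Projectivity of [P s] lifts [f]; the discrepancy with [g] on [K s] takes values in [Y0], extends
    to [P s] there, and is subtracted. *)
Lemma lifting_basic s : lifting (i s).
Proof.
move=> Y0 Y Z j q jq eY f g fg; have [_ _ qs] := jq.
have [l lE] := proj_lift f (@P_proj s) qs.
have [d dE] := lin_sub (l \o i s) g.
have [|d' d'E] := ses_in (h := d) jq; first by move=> x; rewrite dE linearB /= lE fg subrr.
have [e eE] := eY s d'; have [h hE] := lin_sub l (j \o e).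
exists h; split=> x; rewrite hE /=.
  by rewrite eE d'E dE /= opprB addrC subrK.
by rewrite linearB lE (ses0 _ jq) subr0.
Qed.

(** A single pushout along the direct sum of the [i s], one copy for every map [K s -> N], extends
    all these maps at once. The lifting property passes to direct sums and pushouts. *)
Lemma small_object_step N : exists N' (h : {linear N -> N'}),
  [/\ injective h, lifting h & forall s (g : {linear K s -> N}),
      exists e : {linear P s -> N'}, forall x, e (i s x) = h (g x)].
Proof.
pose J := {s : S & {linear K s -> N}}.
have [DK [inK [prK dK]]] := is_dsum_ex (fun j : J => K (projT1 j)).
have [DP [inP [prP dP]]] := is_dsum_ex (fun j : J => P (projT1 j)).
have [m [mE _ mi]] := dsum_map (fun j : J => i (projT1 j)) dK dP.
have [ev evE] := dsum_out dK (fun j : J => projT2 j).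
have [N' [a [h pN]]] := pushout_ex m ev; exists N', h; split.
- by apply: (pushout_inj pN); apply: mi => j; exact: i_inj.
- move=> Y0 Y Z j q jq eY f g fg.
  have H (t : J) : exists e : {linear P (projT1 t) -> Y},
      (forall x, e (i _ x) = g (projT2 t x)) /\ (forall x, q (e x) = f (a (inP t x))).
    have [|e [eg ef]] := lifting_basic jq eY (f := f \o a \o inP t) (g := g \o projT2 t).
      move=> x /=; rewrite fg -evE; congr (f _).
      by rewrite -(pushout_comm pN) mE.
    by exists e.
  have [e eE] := dsum_out dP (fun t => projT1 (cid (H t))).
  have [|w [wa wh]] := pushout_out pN (u := e) (v := g).
    apply: (dsum_hom_eq dK (g := e \o m) (h := g \o ev)) => t x /=.
    by rewrite mE eE evE; case: (cid (H t)) => /= ? [].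
  exists w; split=> // n'; have [x [y ->]] := pushout_gen pN n'.
  rewrite !linearD wa wh fg; congr (_ + _).
  move: x; apply: (dsum_hom_eq dP (g := q \o e) (h := f \o a)) => t x /=.
  by rewrite eE; case: (cid (H t)) => /= ? [].
- move=> s g; exists (a \o inP (existT _ s g)) => x /=.
  by rewrite -[RHS]/(h (projT2 (existT _ s g : J) x)) -evE -(pushout_comm pN) mE.
Qed.

(** A map from a finitely generated [K s] into the union lives at a finite stage and is extended at
    the next one, so the iteration can stop at omega. *)
Lemma small_object N : (forall s, fgens (K s)) -> exists L (c : {linear N -> L}),
  [/\ injective c, lifting c & extends L].
Proof.
move=> fK.
pose next N0 := projT1 (cid (small_object_step N0)).
have nextP N0 : exists h : {linear N0 -> next N0}, [/\ injective h, lifting h &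
    forall s (g : {linear K s -> N0}),
      exists e : {linear P s -> next N0}, forall x, e (i s x) = h (g x)].
  by rewrite /next; case: (cid _).
pose M k := iter k next N.
pose j k : {linear M k -> M k.+1} := projT1 (cid (nextP (M k))).
have jP k : [/\ injective (j k), lifting (j k) & forall s (g : {linear K s -> M k}),
      exists e : {linear P s -> M k.+1}, forall x, e (i s x) = j k (g x)].
  by rewrite /j; case: (cid _).
have ji k : injective (j k) by case: (jP k).
have [L [c cL]] := colimit_ex j; exists L, (c 0%N); split.
- have cI := @colim_inj _ _ _ _ _ cL ji 0%N; exact: cI.
- move=> Y0 Y Z u q uq eY f g fg.
  pose T k := {h : {linear M k -> Y} | forall x, q (h x) = f (c k x)}.
  have nxt k (t : T k) : exists t' : T k.+1, forall x, sval t' (j k x) = sval t x.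
    have [_ lf _] := jP k.
    have [|h [hj hq]] := lf _ _ _ _ _ uq eY (f \o c k.+1) (sval t).
      by move=> x /=; rewrite (svalP t) (colim_comm cL).
    by exists (exist _ h hq).
  (* Lifts are chosen stage by stage, each extending the previous one; keeping the equation with [f]
     in the type [T k] is what lets the recursion go on. *)
  pose t := fix t k : T k := match k return T k with
    | 0 => exist _ g fg
    | k'.+1 => projT1 (cid (nxt k' (t k'))) end.
  have tE k x : sval (t k.+1) (j k x) = sval (t k) x.
    by rewrite /=; case: (cid _) => /= t' ->.
  have [w wE] := colim_out cL tE; exists w; split=> [x|y]; first exact: (wE 0%N x).
  by have [k [x ->]] := colim_gen cL y; rewrite wE (svalP (t k)).
- move=> s g; have [k [g' g'E]] := fgens_colimit g cL ji (fK s).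
  have [_ _ /(_ s g')[e eE]] := jP k.
  by exists (c k.+1 \o e) => x /=; rewrite eE (colim_comm cL) g'E.
Qed.

End SmallObject.

(** * Special preenvelopes and enough injectives *)

Section EnoughInjectives.
Variable R : pzRingType.
Hypothesis nR : left_noetherian R.
Implicit Types (C I L M N Q X Y : lmodType R).

(* Presentations of modules in [S] by free modules of finite rank: a set of
   representatives of the class [S], small enough to index a direct sum. *)
Record presentation_in (S : mod_class R) := PresIn {
  pres_n : nat;
  pres_K : set (freen R pres_n);
  pres_sub : submodule pres_K;
  pres_in : exists Q (p : {linear freen R pres_n -> Q}),
    [/\ surj p, (forall x, p x = 0 <-> pres_K x) & S Q] }.

(** When [i] runs over the kernels of all presentations in [S], [extends] means vanishing of Ext^1
    on [S], and the lifting property of [c] makes its cokernel left orthogonal to all such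
    modules. *)
Lemma special_preenvelope (S : mod_class R) N : (forall M, S M -> fgens M) ->
  exists L X (c : {linear N -> L}) (p : {linear L -> X}),
    [/\ ses c p, forall M, S M -> ext1 M L
      & forall Y, (forall M, S M -> ext1 M Y) -> ext1 X Y].
Proof.
move=> fS; pose J := presentation_in S.
have H (s : J) : exists K : lmodType R, exists i : {linear K -> freen R (pres_n s)},
    injective i /\ forall x, pres_K x <-> exists y, i y = x.
  exact: submodule_ex (pres_sub s).
pose K s := projT1 (cid (H s)); pose i s := projT1 (cid (projT2 (cid (H s)))).
have iP s : injective (i s) /\ forall x, pres_K x <-> exists y, i s y = x.
  exact: (projT2 (cid (projT2 (cid (H s))))).
have extP Y : extends i Y <-> forall M, S M -> ext1 M Y.
  split=> [eY M SM|eY s g].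
    have [n [p ps]] := fgens_cover (fS M SM).
    have [s [sn sK]] : exists s : J, exists e : pres_n s = n,
        forall x, pres_K x <-> p (eq_rect _ (fun n => freen R n : Type) x _ e) = 0.
      have sK := submodule_ker p.
      have inS : exists Q (p0 : {linear freen R n -> Q}),
          [/\ surj p0, (forall x, p0 x = 0 <-> p x = 0) & S Q] by exists M, p.
      by exists (PresIn sK inS), erefl.
    subst n; have [ii iE] := iP s.
    apply: (ext1_pres (i := i s) (p := p)); last exact: (eY s).
      by split=> // y; rewrite -iE; apply: iff_sym; exact: sK.
    exact: projective_freen.
  have [Q [p [ps pK SQ]]] := pres_in s; have [ii iE] := iP s.
  apply: (ext1_extend (p := p) _ (eY Q SQ)).
  by split=> // y; rewrite -iE; exact: pK.
have [||s|L [c [ci cl eL]]] := @small_object R J K _ i _ _ N _.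
- by move=> s; case: (iP s).
- by move=> s; exact: projective_freen.
- by apply: (noeth_sub_fgens (iP s).1); apply: noeth_fgens => //; exact: fgens_freen.
have [X [p cp]] := ses_coker ci; exists L, X, c, p; split=> //.
  by move=> M; exact: (extP L).1.
move=> Y /(extP Y) eY B C j q jq f.
(* A lift of [f \o p] that is zero on [N] descends to the cokernel [X]. *)
have [z zE] := lin_zero N B.
have [|h [hc hq]] := cl _ _ _ j q jq eY (f \o p) z.
  by move=> x; rewrite /= zE (ses0 _ cp) !linear0.
have [|l lE] := ses_out (h := h) cp; first by move=> x; rewrite hc zE.
have [_ _ ps] := cp; exists l.
by apply: (surj_lin_eq (h := q \o l) (k := f) ps) => x /=; rewrite lE hq.
Qed.

(** Each quotient of R by a left ideal is cyclic, so orthogonality to the finitely generated modules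
    contains Baer's criterion. *)
Lemma enough_injectives N :
  exists I C (j : {linear N -> I}) (q : {linear I -> C}), ses j q /\ injmod I.
Proof.
have [I [C [j [q [jq eI _]]]]] := special_preenvelope N (S := @fgens R) (fun _ => id).
exists I, C, j, q; split=> //; apply: baer => J i f ii.
have [Q [p ip]] := ses_coker ii; apply: (ext1_extend ip); apply: eI.
have [_ _ ps] := ip; exact: fgens_surj ps (@fgens_ring R).
Qed.

End EnoughInjectives.
(** * Vanishing of higher Ext *)

Section ExtVanishing.
Variable R : pzRingType.
Implicit Types (A B C D E F G H I J K L M N P Q T U V W X Y Z : lmodType R).

Definition syz M : lmodType R := projT1 (cid (presentation_ex M)).

Lemma syzP M : exists P (i : {linear syz M -> P}) (p : {linear P -> M}),
  projective P /\ ses i p.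
Proof. exact: (projT2 (cid (presentation_ex M))). Qed.

(* Ext^(n+1)(M, N) = 0. *)
Definition Extz n M N : Prop := ext1 (iter n syz M) N.

(** Both sides express Ext^2(M, N) = 0, through a syzygy of [M] or a cosyzygy of [N]. This exchange
    is the source of the independence from the chosen syzygies. *)
Lemma ext1_shift K P M N I C (i : {linear K -> P}) (p : {linear P -> M})
    (j : {linear N -> I}) (q : {linear I -> C}) :
  ses i p -> projective P -> ses j q -> injmod I -> ext1 K N <-> ext1 M C.
Proof.
move=> ip pP jq iI; have [ii _ _] := ip; have [_ _ qs] := jq; split=> e.
  apply: (ext1_pres ip pP) => f; have [h hE] := e _ _ _ _ jq f.
  have [g gE] := iI _ _ i h ii; exists (q \o g) => x.
  by rewrite /= gE hE.
apply: (ext1_copres jq iI) => f; have [g gE] := ext1_extend ip e f.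
have [h hE] := proj_lift g pP qs; exists (h \o i) => x.
by rewrite /= hE gE.
Qed.

(** Fragments of the long exact sequences: [con] varies the first argument, [cov] the second, and
    the final letter is the term whose vanishing is concluded. A cosyzygy or a syzygy stands for the
    next degree. *)
Lemma ext1_conB A B C N (i : {linear A -> B}) (p : {linear B -> C}) I D
    (j : {linear N -> I}) (q : {linear I -> D}) : ses i p -> ses j q -> injmod I ->
  ext1 A N -> ext1 C N -> ext1 B N.
Proof.
move=> ip jq iI eA eC; apply: (ext1_copres jq iI) => f; have [ii _ _] := ip.
have [a aE] := eA _ _ _ _ jq (f \o i).
have [b bE] := iI _ _ i a ii; have [d dE] := lin_sub f (q \o b).
have [|g gE] := ses_out (h := d) ip; first by move=> x; rewrite dE /= bE aE subrr.
have [c cE] := eC _ _ _ _ jq g.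
exists (b \+ (c \o p)) => x; rewrite linearD /= cE gE dE /=.
by rewrite addrC subrK.
Qed.

Lemma ext1_conA A B C N (i : {linear A -> B}) (p : {linear B -> C}) I D
    (j : {linear N -> I}) (q : {linear I -> D}) : ses i p -> ses j q -> injmod I ->
  ext1 B N -> ext1 C D -> ext1 A N.
Proof.
move=> ip jq iI eB eC; apply: (ext1_copres jq iI) => f.
have [g gE] := ext1_extend ip eC f; have [h hE] := eB _ _ _ _ jq g.
by exists (h \o i) => x; rewrite /= hE gE.
Qed.

(** The lifting hypothesis says that the connecting map from Hom(M, C) to Ext^1(M, A) is zero, so
    that Ext^1(M, A) embeds in Ext^1(M, B). *)
Lemma ext1_cov_lift A B C M (i : {linear A -> B}) (p : {linear B -> C}) : ses i p ->
  (forall f : {linear M -> C}, exists g : {linear M -> B}, forall x, p (g x) = f x) ->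
  ext1 M B -> ext1 M A.
Proof.
move=> ip lft eB; have [P [j [q [pP jq]]]] := syzP M.
apply: (ext1_pres jq pP) => f; have [ii _ _] := ip.
have [h hE] := ext1_extend jq eB (i \o f).
have [|g gE] := ses_out (h := p \o h) jq; first by move=> x; rewrite /= hE /= (ses0 _ ip).
have [l lE] := lft g; have [d dE] := lin_sub h (l \o q).
have [|k kE] := ses_in (h := d) ip; first by move=> x; rewrite dE linearB /= lE gE subrr.
by exists k => x; apply: ii; rewrite kE dE hE /= (ses0 _ jq) linear0 subr0.
Qed.

Lemma ext1_covA A B C M (i : {linear A -> B}) (p : {linear B -> C}) : ses i p ->
  ext1 M C -> ext1 (syz M) B -> ext1 (syz M) A.
Proof.
move=> ip eC; have [P [j [q [pP jq]]]] := syzP M; have [_ _ ps] := ip.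
apply: (ext1_cov_lift ip) => f; have [g gE] := ext1_extend jq eC f.
have [h hE] := proj_lift g pP ps.
by exists (h \o j) => x; rewrite /= hE gE.
Qed.

Lemma ext1_covB A B C M (i : {linear A -> B}) (p : {linear B -> C}) : ses i p ->
  ext1 M A -> ext1 M C -> ext1 M B.
Proof.
move=> ip eA eC; have [P [j [q [pP jq]]]] := syzP M; have [_ _ ps] := ip.
apply: (ext1_pres jq pP) => f; have [g gE] := ext1_extend jq eC (p \o f).
have [h hE] := proj_lift g pP ps; have [d dE] := lin_sub f (h \o j).
have [|d' d'E] := ses_in (h := d) ip.
  by move=> x; rewrite dE linearB /= hE gE /= subrr.
have [e eE] := ext1_extend jq eA d'.
exists (h \+ (i \o e)) => x /=; rewrite eE d'E dE /=.
by rewrite addrC subrK.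
Qed.

Lemma ext1_covC A B C M (i : {linear A -> B}) (p : {linear B -> C}) : ses i p ->
  ext1 M B -> ext1 (syz M) A -> ext1 M C.
Proof.
move=> ip eB eA; have [P [j [q [pP jq]]]] := syzP M.
apply: (ext1_pres jq pP) => f; have [g gE] := eA _ _ _ _ ip f.
have [h hE] := ext1_extend jq eB g.
by exists (p \o h) => x; rewrite /= hE gE.
Qed.

Definition retract X Y : Prop :=
  exists (i : {linear X -> Y}) (p : {linear Y -> X}), forall x, p (i x) = x.

Lemma ext1_retract_l X Y N : retract X Y -> ext1 Y N -> ext1 X N.
Proof.
move=> [i [p pi]] e B C j q jq f; have [h hE] := e _ _ _ _ jq (f \o p).
by exists (h \o i) => x; rewrite /= hE /= pi.
Qed.

Lemma ext1_retract_r X Y M : retract X Y -> ext1 M Y -> ext1 M X.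
Proof.
move=> [i [p pi]] e; have [P [j [q [pP jq]]]] := syzP M.
apply: (ext1_pres jq pP) => f; have [h hE] := ext1_extend jq e (i \o f).
by exists (p \o h) => x; rewrite /= hE /= pi.
Qed.

Lemma ext1_dsum_l (S : Type) (M : S -> lmodType R) D N
    (inj : forall s, {linear M s -> D}) (pr : forall s, {linear D -> M s}) :
  is_dsum inj pr -> (forall s, ext1 (M s) N) -> ext1 D N.
Proof.
move=> dD e B C j q jq f.
have H s : exists h : {linear M s -> B}, forall x, q (h x) = (f \o inj s) x.
  exact: (e s _ _ _ _ jq).
have [h hE] := dsum_out dD (fun s => projT1 (cid (H s))).
exists h; apply: (dsum_hom_eq dD (g := q \o h)) => s x /=.
by rewrite hE; case: (cid (H s)) => /= g ->.
Qed.

Lemma retract_trans X Y Z : retract X Y -> retract Y Z -> retract X Z.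
Proof.
move=> [i [p pi]] [j [q qj]]; exists (j \o i), (p \o q) => x.
by rewrite /= qj pi.
Qed.

Lemma retract_refl X : retract X X.
Proof. by have [i iE] := lin_id X; exists i, i => x; rewrite !iE. Qed.

Lemma retract_iso X Y (f : {linear X -> Y}) : injective f -> surj f -> retract X Y /\ retract Y X.
Proof.
move=> fi fs; have [i iE] := lin_id Y.
have [|g gE] := factor_inj (g := i) fi; first by move=> y; rewrite iE; exact: fs.
have gf x : g (f x) = x by apply: fi; rewrite gE iE.
split; first by exists f, g.
by exists g, f => y; rewrite gE iE.
Qed.

Lemma projective_retract X Y : retract X Y -> projective Y -> projective X.
Proof.
move=> [i [p pi]] pY A B q f qs; have [h hE] := proj_lift (f \o p) pY qs.
by exists (h \o i) => x; rewrite /= hE /= pi.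
Qed.

Lemma ext1_projectiveP M : (forall N, ext1 M N) <-> projective M.
Proof.
split=> [e A B p f ps|pM N]; last exact: ext1_proj.
by have [K [i ip]] := ses_ker ps; exact: (e K _ _ _ _ ip).
Qed.

Lemma Extz_covA n A B C M (i : {linear A -> B}) (p : {linear B -> C}) : ses i p ->
  Extz n M C -> Extz n.+1 M B -> Extz n.+1 M A.
Proof. exact: ext1_covA. Qed.

Lemma Extz_covB n A B C M (i : {linear A -> B}) (p : {linear B -> C}) : ses i p ->
  Extz n M A -> Extz n M C -> Extz n M B.
Proof. exact: ext1_covB. Qed.

Lemma Extz_covC n A B C M (i : {linear A -> B}) (p : {linear B -> C}) : ses i p ->
  Extz n M B -> Extz n.+1 M A -> Extz n M C.
Proof. exact: ext1_covC. Qed.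

Lemma Extz_retract_r n X Y M : retract X Y -> Extz n M Y -> Extz n M X.
Proof. exact: ext1_retract_r. Qed.

Lemma Extz_cosyz n M N I C (j : {linear N -> I}) (q : {linear I -> C}) :
  ses j q -> injmod I -> Extz n.+1 M N <-> Extz n M C.
Proof.
move=> jq iI; have [P [i [p [pP ip]]]] := syzP (iter n syz M).
exact: ext1_shift ip pP jq iI.
Qed.

Hypothesis nR : left_noetherian R.

Definition cosyz N : lmodType R := projT1 (cid (projT2 (cid (enough_injectives nR N)))).

Lemma cosyzP N : exists I (j : {linear N -> I}) (q : {linear I -> cosyz N}),
  ses j q /\ injmod I.
Proof.
exists (projT1 (cid (enough_injectives nR N))).
exact: (projT2 (cid (projT2 (cid (enough_injectives nR N))))).
Qed.

Lemma ExtzS n M N : Extz n.+1 M N <-> Extz n M (cosyz N).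
Proof. by have [I [j [q [jq iI]]]] := cosyzP N; exact: Extz_cosyz jq iI. Qed.

Lemma Extz_iter n k M N : Extz (n + k) M N <-> Extz n M (iter k cosyz N).
Proof.
elim: k N => [|k IH] N; first by rewrite addn0.
by rewrite addnS iterSr ExtzS; exact: IH.
Qed.

(* Degree 0 is the only place where the chosen presentation of [M] matters: there
   both sides are Ext^1(M, cosyz N). *)
Lemma Extz_syz n K P M N (i : {linear K -> P}) (p : {linear P -> M}) :
  ses i p -> projective P -> Extz n.+1 M N <-> Extz n K N.
Proof.
move=> ip pP; elim: n N => [|n IH] N; last by rewrite ExtzS IH -ExtzS.
have [I [j [q [jq iI]]]] := cosyzP N.
rewrite ExtzS; exact: iff_sym (ext1_shift ip pP jq iI).
Qed.

Lemma Extz_conA n A B C N (i : {linear A -> B}) (p : {linear B -> C}) : ses i p ->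
  Extz n B N -> Extz n.+1 C N -> Extz n A N.
Proof.
move=> ip; elim: n N => [|n IH] N; last by rewrite !ExtzS => ? ?; apply: IH; rewrite ?ExtzS.
have [I [j [q [jq iI]]]] := cosyzP N.
by rewrite ExtzS; exact: ext1_conA ip jq iI.
Qed.

Lemma Extz_conB n A B C N (i : {linear A -> B}) (p : {linear B -> C}) : ses i p ->
  Extz n A N -> Extz n C N -> Extz n B N.
Proof.
move=> ip; elim: n N => [|n IH] N; last by rewrite !ExtzS; exact: IH.
have [I [j [q [jq iI]]]] := cosyzP N.
exact: ext1_conB ip jq iI.
Qed.

Lemma Extz_retract_l n X Y N : retract X Y -> Extz n Y N -> Extz n X N.
Proof.
move=> XY; elim: n N => [|n IH] N; last by rewrite !ExtzS; exact: IH.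
exact: ext1_retract_l.
Qed.

Lemma Extz_dsum_l n (S : Type) (M : S -> lmodType R) D N
    (inj : forall s, {linear M s -> D}) (pr : forall s, {linear D -> M s}) :
  is_dsum inj pr -> (forall s, Extz n (M s) N) -> Extz n D N.
Proof.
move=> dD; elim: n N => [|n IH] N e; first exact: (ext1_dsum_l dD).
by rewrite ExtzS; apply: IH => s; rewrite -ExtzS.
Qed.

Lemma Extz_proj n P N : projective P -> Extz n P N.
Proof.
by move=> pP; elim: n N => [|n IH] N; [exact: ext1_proj|rewrite ExtzS].
Qed.

(** A map from the finitely generated syzygy into [D] is extended componentwise. Almost all
    components are zero, and extending these by zero keeps the family finite at each point, so it
    defines a map into [D]. *)
Lemma Extz_dsum_r n (S : Type) (N : S -> lmodType R) D M
    (inj : forall s, {linear N s -> D}) (pr : forall s, {linear D -> N s}) :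
  is_dsum inj pr -> fgens M -> (forall s, Extz n M (N s)) -> Extz n M D.
Proof.
move=> dD; elim: n M => [|n IH] M fM e.
  have [K [m [i [p [ip [t tP]]]]]] := fgens_presentation nR fM.
  apply: (ext1_pres ip (@projective_freen _ _)) => f.
  have H s : exists g : {linear freen R m -> N s}, (forall x, g (i x) = pr s (f x)) /\
      ((forall x, pr s (f x) = 0) -> forall y, g y = 0).
    have [z|nz] := pselect (forall x, pr s (f x) = 0).
      by have [g gE] := lin_zero (freen R m) (N s); exists g; split=> // x; rewrite gE z.
    by have [g gE] := ext1_extend ip (e s) (pr s \o f); exists g; split.
  pose g s := projT1 (cid (H s)).
  have gP s : (forall x, g s (i x) = pr s (f x)) /\
      ((forall x, pr s (f x) = 0) -> forall y, g s y = 0) := projT2 (cid (H s)).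
  have [a|h hE] := dsum_in dD (g := g).
    apply: (@sub_finite_set _ _ [set s | exists2 x, x \in t & pr s (f x) <> 0]).
      move=> s /= gs; apply: contrapT => nx; apply: gs; apply: (gP s).2.
      apply: (tP (fun x => pr s (f x) = 0)); first exact: (submodule_ker (pr s \o f)).
      by move=> x xt; apply: contrapT => xs; apply: nx; exists x.
    elim: t {tP} => [|x t IHt].
      by rewrite (_ : [set _ | _] = set0) //; apply/seteqP; split=> // s [].
    apply: (@sub_finite_set _ _ ([set s | pr s (f x) <> 0] `|`
        [set s | exists2 x, x \in t & pr s (f x) <> 0])).
      move=> s /= [y]; rewrite inE => /orP[/eqP ->|yt ys]; first by left.
      by right; exists y.
    by rewrite finite_setU; split=> //; exact: (dsum_fin dD (f x)).
  exists h => x; apply/subr0_eq/(dsum_ext dD) => s.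
  by rewrite linearB hE (gP s).1 subrr.
have [K [m [i [p [ip fK]]]]] := fgens_presentation nR fM.
rewrite (Extz_syz _ _ ip); last exact: projective_freen.
apply: IH => // s; rewrite -(Extz_syz _ _ ip) //; exact: projective_freen.
Qed.

(** Dropping [P 0] leaves a resolution of the kernel of [e], which lowers the degree by one. *)
Lemma Hom_cohomology_of_Extz i M N (P : nat -> lmodType R)
    (d : forall k, {linear P k.+1 -> P k}) (e : {linear P 0%N -> M}) :
  (forall k, projective (P k)) -> resolution d e -> Extz i M N ->
  Hom_cohomology_eq0 d N i.+1.
Proof.
elim: i M P d e => [|i IH] M P d e pP [es d0e dd] eM.
  have [K [j je]] := ses_ker es.
  have [|p pE] := ses_in (h := d 0%N) je; first by move=> x; apply/d0e; exists x.
  have [ji je0 _] := je.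
  have ps : surj p.
    move=> k; have /d0e[x dx] : e (j k) = 0 by exact: (ses0 _ je).
    by exists x; apply: ji; rewrite pE.
  move=> f fd; have [b pb|g gE] := factor_surj (g := f) ps.
    by have /dd[x <-] : d 0%N b = 0 by rewrite -pE pb linear0.
  have [h hE] := ext1_extend je eM g; exists h => x.
  by rewrite -pE hE gE.
have [K [j je]] := ses_ker es.
have [|p pE] := ses_in (h := d 0%N) je; first by move=> x; apply/d0e; exists x.
have [ji je0 _] := je.
apply: (IH K (fun k => P k.+1) (fun k => d k.+1) p) => //.
  split=> //.
    move=> k; have /d0e[x dx] : e (j k) = 0 by exact: (ses0 _ je).
    by exists x; apply: ji; rewrite pE.
  move=> y; rewrite -dd -pE; split=> [->|py]; first by rewrite linear0.
  by apply: ji; rewrite py linear0.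
by rewrite -(Extz_syz _ _ je).
Qed.

(** From left to right, test on the resolution spliced from the chosen syzygies; from right to left
    every projective resolution is covered. *)
Lemma Ext_eq0P i M N : Ext_eq0 i.+1 M N <-> Extz i M N.
Proof.
split=> [e|e P d a pP r]; last exact: Hom_cohomology_of_Extz pP r e.
pose P k := projT1 (cid (syzP (iter k syz M))).
pose j k : {linear iter k.+1 syz M -> P k} := projT1 (cid (projT2 (cid (syzP (iter k syz M))))).
have H k : exists p : {linear P k -> iter k syz M}, projective (P k) /\ ses (j k) p.
  exact: (projT2 (cid (projT2 (cid (syzP (iter k syz M)))))).
pose p k := projT1 (cid (H k)).
have pP k : projective (P k) /\ ses (j k) (p k) := projT2 (cid (H k)).
have jp k : ses (j k) (p k) by case: (pP k).
have /e : resolution (fun k => j k \o p k.+1) (p 0%N).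
  split; first by case: (jp 0%N).
    move=> y; have [_ -> _] := jp 0%N; have [_ _ ps] := jp 1%N.
    split=> [[x <-]|[x <-]]; last by exists (p 1%N x).
    by have [z <-] := ps x; exists z.
  move=> k y /=; have [ji _ _] := jp k; have [_ pe _] := jp k.+1.
  have [_ _ ps] := jp k.+2.
  split=> [jp0|[x <-]]; last by rewrite (ses0 _ (jp _)) linear0.
  have /pe[x <-] : p k.+1 y = 0 by apply: ji; rewrite jp0 linear0.
  by have [z <-] := ps x; exists z.
move=> /(_ (fun k => (pP k).1)) coh.
have [_ _ ps] := jp i.+1; apply: (ext1_pres (jp i) (pP i).1) => f.
have [x|g gE] := coh (f \o p i.+1); first by rewrite /= (ses0 _ (jp _)) linear0.
by exists g; apply: (surj_lin_eq (h := g \o j i) (k := f) ps) => x /=; rewrite -gE.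
Qed.

End ExtVanishing.
(** * Dimensions *)

Section Resolutions.
Variable R : pzRingType.
Implicit Types (A B D I K L M N P Q T U V W X Y Z : lmodType R) (C : mod_class R).

Definition iso_closed C : Prop := forall A B (f : {linear A -> B}),
  injective f -> surj f -> C A -> C B.

Lemma iso_inv A B (f : {linear A -> B}) : injective f -> surj f ->
  exists g : {linear B -> A}, injective g /\ surj g.
Proof.
move=> fi fs; have [i iE] := lin_id B.
have [|g gE] := factor_inj (g := i) fi; first by move=> y; rewrite iE; exact: fs.
exists g; split=> [x y e|x]; last by exists (f x); apply: fi; rewrite gE iE.
by rewrite -(iE x) -(iE y) -!gE e.
Qed.

(** [res_dim_le] cut into short exact sequences, for induction. Length 0 asks for [C M] itself and
    not for an isomorphic copy, hence [iso_closed] in the comparison. *)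
Fixpoint resd C n M : Prop := if n is k.+1 then
    exists K P (i : {linear K -> P}) (p : {linear P -> M}), [/\ ses i p, C P & resd C k K]
  else C M.

Fixpoint coresd C n X : Prop := if n is k.+1 then
    exists T Y (i : {linear X -> T}) (p : {linear T -> Y}), [/\ ses i p, C T & coresd C k Y]
  else C X.

Lemma freen0_trivial : trivial_mod (freen R 0).
Proof. by move=> x; apply: funext => -[]. Qed.

Lemma res_dim_leP C n M : iso_closed C -> res_dim_le C M n <-> resd C n M.
Proof.
move=> isoC; split.
  elim: n M => [|n IH] M [P [d [e [[es d0e dd] PC Ptriv]]]].
    apply: (isoC _ _ e) => //; last exact: PC.
    by apply: inj0P => x /d0e[y <-]; rewrite (Ptriv 1%N _ y)// linear0.
  have [K [j je]] := ses_ker es; exists K, (P 0%N), j, e; split=> //; first exact: PC.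
  have [|p pE] := ses_in (h := d 0%N) je; first by move=> x; apply/d0e; exists x.
  have [ji je0 _] := je; apply: IH.
  exists (fun k => P k.+1), (fun k => d k.+1), p; split=> //; last first.
  - by move=> i ni; exact: Ptriv.
  - by move=> i ni; exact: PC.
  split=> //.
    move=> k; have /d0e[x dx] : e (j k) = 0 by exact: (ses0 _ je).
    by exists x; apply: ji; rewrite pE.
  move=> y; rewrite -dd -pE; split=> [->|py]; first by rewrite linear0.
  by apply: ji; rewrite py linear0.
elim: n M => [|n IH] M.
  move=> CM; have [z zE] := lin_zero (freen R 0) M.
  have [z' z'E] := lin_zero (freen R 0) (freen R 0).
  pose P k : lmodType R := if k is 0 then M else freen R 0.
  pose d k : {linear P k.+1 -> P k} := match k with 0 => z | _.+1 => z' end.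
  have [e eE] := lin_id M.
  exists P, d, e; split.
  - split.
    + by move=> y; exists y; rewrite eE.
    + by move=> y; rewrite eE; split=> [->|[x <-]]; [exists 0; exact: zE|exact: zE].
    + move=> i y; split=> [_|[x <-]].
        by exists 0; rewrite linear0; apply/esym/freen0_trivial.
      by rewrite (_ : d i.+1 x = 0) ?linear0//; exact: freen0_trivial.
  - by case.
  - by case=> // i _; exact: freen0_trivial.
move=> [K [P0 [i [p [ip CP /IH[P [d [e [[es d0e dd] PC Ptriv]]]]]]]]].
pose P' k : lmodType R := if k is k'.+1 then P k' else P0.
pose d' k : {linear P' k.+1 -> P' k} := match k with 0 => i \o e | k'.+1 => d k' end.
have [ii ie ps] := ip.
exists P', d', p; split.
- split=> //.
  + move=> y; rewrite ie; split=> [[x <-]|[x <-]]; last by exists (e x).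
    by have [z <-] := es x; exists z.
  + case=> [|k] y; last exact: dd.
    rewrite /= -d0e; split=> [iy|->]; last by rewrite linear0.
    by apply: ii; rewrite iy linear0.
- by case=> // k; exact: PC.
- by case=> // k; exact: Ptriv.
Qed.

(** [ring_coresolution] for an arbitrary module, since induction on the length replaces R by
    cokernels. *)
Definition coresolution C X r : Prop :=
  exists (T_ : nat -> lmodType R) (d : forall i, {linear T_ i -> T_ i.+1})
    (e : {linear X -> T_ 0%N}),
    [/\ injective e,
        exact e (d 0%N),
        forall i, exact (d i) (d i.+1),
        forall i, (i <= r)%N -> C (T_ i)
      & forall i, (r < i)%N -> trivial_mod (T_ i)].

Lemma coresolutionP C n X : iso_closed C -> coresolution C X n <-> coresd C n X.
Proof.
move=> isoC; split.
  elim: n X => [|n IH] X [P [d [e [ei d0e dd PC Ptriv]]]].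
    have es : surj e by move=> y; apply/d0e; exact: (Ptriv 1%N).
    have [f [fi fs]] := iso_inv ei es.
    by apply: (isoC _ _ f) => //; exact: PC.
  have [Y [q eq]] := ses_coker ei.
  exists (P 0%N), Y, e, q; split=> //; first exact: PC.
  have [|f fE] := ses_out (h := d 0%N) eq; first by move=> x; apply/d0e; exists x.
  have [_ qe qs] := eq.
  apply: IH; exists (fun k => P k.+1), (fun k => d k.+1), f; split=> //.
  - apply: inj0P => y; have [x <-] := qs y; rewrite fE => /d0e[z <-].
    exact: (ses0 _ eq).
  - move=> y; rewrite dd; split=> [[x <-]|[x <-]]; first by exists (q x).
    by have [z <-] := qs x; exists z.
  - by move=> i ni; exact: PC.
  - by move=> i ni; exact: Ptriv.
elim: n X => [|n IH] X.
  move=> CX; have [z zE] := lin_zero X (freen R 0).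
  have [z' z'E] := lin_zero (freen R 0) (freen R 0).
  pose P k : lmodType R := if k is 0 then X else freen R 0.
  pose d k : {linear P k -> P k.+1} := match k with 0 => z | _.+1 => z' end.
  have [e eE] := lin_id X.
  exists P, d, e; split.
  - by move=> x y; rewrite !eE.
  - by move=> y; split=> [_|[x <-]]; [exists y; rewrite eE|exact: zE].
  - move=> i y; split=> [_|[x <-]]; last exact: freen0_trivial.
    by exists 0; rewrite linear0; apply/esym/freen0_trivial.
  - by case.
  - by case=> // i _; exact: freen0_trivial.
move=> [P0 [Y [i [p [ip CP /IH[P [d [e [ei d0e dd PC Ptriv]]]]]]]]].
pose P' k : lmodType R := if k is k'.+1 then P k' else P0.
pose d' k : {linear P' k -> P' k.+1} := match k with 0 => e \o p | k'.+1 => d k' end.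
have [ii ie ps] := ip.
exists P', d', i; split=> //.
- move=> y; rewrite -ie /=; split=> [ey|->]; last by rewrite linear0.
  by apply: ei; rewrite ey linear0.
- case=> [|k] y; last exact: dd.
  rewrite /= d0e; split=> [[x <-]|[x <-]]; last by exists (p x).
  by have [z <-] := ps x; exists z.
- by case=> // k; exact: PC.
- by case=> // k; exact: Ptriv.
Qed.

Lemma resd_sub C C' n M : (forall X, C X -> C' X) -> resd C n M -> resd C' n M.
Proof.
move=> CC'; elim: n M => [|n IH] M; first exact: CC'.
by move=> [K [P [i [p [ip CP rK]]]]]; exists K, P, i, p; split; [|exact: CC'|exact: IH].
Qed.

Lemma coresd_sub C C' n X : (forall Y, C Y -> C' Y) -> coresd C n X -> coresd C' n X.
Proof.
move=> CC'; elim: n X => [|n IH] X; first exact: CC'.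
by move=> [T [Y [i [p [ip CT CY]]]]]; exists T, Y, i, p; split; [|exact: CC'|exact: IH].
Qed.

Lemma retract_closed_iso C :
  (forall X Y, retract X Y -> C Y -> C X) -> iso_closed C.
Proof. by move=> cC A B f fi fs; apply: cC; have [] := retract_iso fi fs. Qed.

Lemma iso_closed_projective : iso_closed (@projective R).
Proof. by apply: retract_closed_iso => X Y; exact: projective_retract. Qed.

Lemma AddP T X : Add T X <-> exists S : Type, retract X (dsum S T).
Proof.
split=> [[S [Y [f fb]]]|[S [i [p pi]]]]; exists S.
  have fs : surj f by case: fb => g _ fg y; exists (g y).
  have [fr _] := retract_iso (bij_inj fb) fs.
  apply: retract_trans fr.
  have [l lE] := lin_inl X Y; have [q qE] := lin_fst X Y.
  by exists l, q => x; rewrite qE lE.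
have ps : surj p by move=> x; exists (i x).
have [Y [j jp]] := ses_ker ps; have [f fE] := lin_copair i j.
have [ji je _] := jp.
have fi : injective f.
  apply: inj0P => -[x y]; rewrite fE /= => e.
  have x0 : x = 0 by have := congr1 p e; rewrite linearD pi (ses0 _ jp) linear0 addr0.
  by move: e; rewrite x0 linear0 add0r => jy; rewrite (ji y 0) ?linear0.
have fs y : exists x, f x = y.
  have /je[z zE] : p (y - i (p y)) = 0 by rewrite linearB pi subrr.
  by exists (p y, z); rewrite fE /= zE addrC subrK.
have /choice[g gK] := fs.
by exists Y, f; exists g => x; [apply: fi; rewrite gK|exact: gK].
Qed.

Lemma Add_dsum (S : Type) T : Add T (dsum S T).
Proof. by apply/AddP; exists S; exact: retract_refl. Qed.

Lemma Add_retract T X Y : retract X Y -> Add T Y -> Add T X.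
Proof. by move=> XY /AddP[S YS]; apply/AddP; exists S; exact: retract_trans XY YS. Qed.

Lemma Add_refl T : Add T T.
Proof.
apply/AddP; exists unit; have [inj [pr dD]] := dsum_is_dsum unit T.
by exists (inj tt), (pr tt) => x; exact: (dsum_prK dD).
Qed.

Lemma inf_enatP (S : nat -> Prop) n :
  inf_enat S = Some n <-> S n /\ forall m, S m -> (n <= m)%N.
Proof.
rewrite /inf_enat; case: pselect => [e|ne]; last first.
  by split=> // -[Sn _]; case: ne; exists n; exact/asboolP.
case: ex_minnP => m /asboolP Sm mP; split=> [[<-]|[Sn nP]].
  by split=> // k Sk; apply: mP; exact/asboolP.
congr Some; apply/eqP; rewrite eqn_leq nP// andbT.
by apply: mP; exact/asboolP.
Qed.

Lemma inf_enat_Some (S : nat -> Prop) :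
  inf_enat S <> None <-> exists n, inf_enat S = Some n.
Proof. by case: inf_enat => [n|]; split=> //; [exists n|case]. Qed.

Lemma inf_enat_ex (S : nat -> Prop) : inf_enat S <> None <-> exists n, S n.
Proof.
rewrite /inf_enat; case: pselect => [e|ne]; split=> //.
  by case: ex_minnP => m /asboolP Sm _ _; exists m.
by move=> [n Sn]; case: ne; exists n; exact/asboolP.
Qed.

Hypothesis nR : left_noetherian R.

(** Projective dimension at most n: [Extz n] is Ext in degree n + 1. *)
Definition pdle n M : Prop := forall N, Extz n M N.

Lemma pdle_resd n M : pdle n M <-> resd (@projective R) n M.
Proof.
elim: n M => [|n IH] M; first exact: ext1_projectiveP.
split=> [pM|[K [P [i [p [ip pP /IH pK]]]]] N].
  have [P [i [p [pP ip]]]] := syzP M; exists (syz M), P, i, p; split=> //.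
  by apply/IH => N; rewrite -(Extz_syz nR _ _ ip).
by rewrite (Extz_syz nR _ _ ip).
Qed.

Lemma pdle_add n k M N : pdle n M -> Extz (n + k) M N.
Proof. by move=> pM; rewrite (Extz_iter nR). Qed.

Lemma pdle_mono n m M : (n <= m)%N -> pdle n M -> pdle m M.
Proof. by move=> nm pM N; rewrite -(subnKC nm); exact: pdle_add. Qed.

Lemma pd_SomeP M n : pd M = Some n <-> pdle n M /\ forall m, pdle m M -> (n <= m)%N.
Proof.
rewrite /pd inf_enatP (res_dim_leP _ _ iso_closed_projective) -pdle_resd.
split=> -[pM nP]; split=> // m;
  first by move=> /pdle_resd/(res_dim_leP _ _ iso_closed_projective)/nP.
by move=> /(res_dim_leP _ _ iso_closed_projective)/pdle_resd/nP.
Qed.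

Lemma fin_pdP M : fin_pd M <-> fgens M /\ exists n, pdle n M.
Proof.
rewrite /fin_pd finitely_generatedP /pd inf_enat_ex.
split=> -[fM [n pM]]; split=> //; exists n.
  by apply/pdle_resd/(res_dim_leP _ _ iso_closed_projective).
by apply/(res_dim_leP _ _ iso_closed_projective)/pdle_resd.
Qed.

Lemma fin_pd_pd M : fin_pd M -> exists m, pd M = Some m.
Proof. by move=> [_]; exact: (inf_enat_Some _).1. Qed.

Lemma findim_SomeP n : findim R = Some n <->
  (forall M, fin_pd M -> pdle n M) /\
  forall m, (forall M, fin_pd M -> pdle m M) -> (n <= m)%N.
Proof.
have E m : (forall M, fin_pd M -> forall k, pd M = Some k -> (k <= m)%N) <->
    (forall M, fin_pd M -> pdle m M).
  split=> H M fM; last by move=> k /pd_SomeP[_]; apply; exact: H.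
  have [k pM] := fin_pd_pd fM; apply: (pdle_mono (H M fM k pM)).
  by have /pd_SomeP[] := pM.
rewrite /findim inf_enatP E; split=> -[fn nP]; split=> // m /E; exact: nP.
Qed.

End Resolutions.
(** * Tilting modules *)

Section Tilting.
Variable R : pzRingType.
Implicit Types (A B D I K L M N P Q T U V W X Y Z : lmodType R) (C : mod_class R).
Hypothesis nR : left_noetherian R.

Definition perp_right C N : Prop := forall M, C M -> forall k, Extz k M N.

Definition perp_left C M : Prop := forall N, perp_right C N -> ext1 M N.

Definition ker_class C M : Prop := perp_left C M /\ perp_right C M.

Lemma perp_infty_rightP C N : perp_infty_right C N <-> perp_right C N.
Proof.
split=> pN M CM k; first by apply/(Ext_eq0P nR)/pN.
by case: k => // k _; apply/(Ext_eq0P nR)/pN.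
Qed.

Lemma kernelP C M : kernel (perp_pair C) M <-> ker_class C M.
Proof.
rewrite /kernel /= perp_infty_rightP; split=> -[aM bM]; split=> // N pN.
  by apply/(Ext_eq0P nR 0)/aM/perp_infty_rightP.
by apply/(Ext_eq0P nR 0)/aM/perp_infty_rightP.
Qed.

Lemma perp_right_iter C N k : perp_right C N -> perp_right C (iter k (cosyz nR) N).
Proof. by move=> pN M CM j; rewrite -(Extz_iter nR); exact: pN. Qed.

(** The left class is defined by Ext^1 alone, but the right class is closed under cosyzygies, which
    brings every degree down to Ext^1. *)
Lemma perp_left_Extz C M N k : perp_left C M -> perp_right C N -> Extz k M N.
Proof.
move=> lM rN; rewrite -[k]add0n (Extz_iter nR).
exact/lM/perp_right_iter.
Qed.

Lemma perp_left_retract C X Y : retract X Y -> perp_left C Y -> perp_left C X.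
Proof. by move=> XY lY N rN; apply: (ext1_retract_l XY); exact: lY. Qed.

Lemma perp_right_retract C X Y : retract X Y -> perp_right C Y -> perp_right C X.
Proof. by move=> XY rY M CM k; apply: (Extz_retract_r XY); exact: rY. Qed.

Lemma perp_left_ses C X Y Z (i : {linear X -> Y}) (p : {linear Y -> Z}) :
  ses i p -> perp_left C X -> perp_left C Z -> perp_left C Y.
Proof.
move=> ip lX lZ N rN; apply: (Extz_conB (n := 0) nR ip); [exact: lX|exact: lZ].
Qed.

Lemma perp_right_ses C X Y Z (i : {linear X -> Y}) (p : {linear Y -> Z}) :
  ses i p -> perp_right C X -> perp_right C Z -> perp_right C Y.
Proof.
by move=> ip rX rZ M CM k; apply: (Extz_covB ip); [exact: rX|exact: rZ].
Qed.

Lemma perp_left_dsum C (S : Type) T : perp_left C T -> perp_left C (dsum S T).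
Proof.
move=> lT N rN; have [inj [pr dD]] := dsum_is_dsum S T.
by apply: (ext1_dsum_l dD) => s; exact: lT.
Qed.

Lemma perp_right_dsum C (S : Type) T : (forall M, C M -> fgens M) ->
  perp_right C T -> perp_right C (dsum S T).
Proof.
move=> fC rT M CM k; have [inj [pr dD]] := dsum_is_dsum S T.
by apply: (Extz_dsum_r nR dD (fC M CM)) => s; exact: rT.
Qed.

(** Ext^(k+1)(M, L) is Ext^1 of a k-th syzygy of [M], which can be chosen in [C]. *)
Lemma perp_right_syz C L : (forall M, C M -> exists K P (i : {linear K -> P}) (p : {linear P -> M}),
    [/\ ses i p, projective P & C K]) ->
  (forall M, C M -> ext1 M L) -> perp_right C L.
Proof.
move=> sC eL M CM k; elim: k M CM => [|k IH] M CM; first exact: eL.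
have [K [P [i [p [ip pP CK]]]]] := sC M CM.
by rewrite (Extz_syz nR _ _ ip pP); exact: IH.
Qed.

Definition self_orth T : Prop := forall k (S : Type), Extz k T (dsum S T).

(** [N] is orthogonal to Add T, hence to whatever Add T coresolves, in particular to the cokernel of
    R -> T0. So every map R -> N extends to T0, and every element of [N] is reached from copies of
    [T]. *)
Lemma tilting_cover T r N : self_orth T -> coresd (Add T) r (R^o : lmodType R) ->
  (forall k, Extz k T N) -> exists (S : Type) K (j : {linear K -> dsum S T})
    (p : {linear dsum S T -> N}), ses j p /\ forall k, Extz k T K.
Proof.
move=> oT coT eN.
have eAdd X k : Add T X -> Extz k X N.
  move=> /AddP[S XS]; apply: (Extz_retract_l nR XS).
  have [inj [pr dD]] := dsum_is_dsum S T.
  by apply: (Extz_dsum_l nR dD).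
have eco n X k : coresd (Add T) n X -> Extz k X N.
  elim: n X k => [|n IH] X k; first exact: eAdd.
  move=> [T0 [Y [i [p [ip aT cY]]]]].
  by apply: (Extz_conA nR ip); [exact: eAdd|exact: IH].
have [T0 [u [aT0 ext]]] : exists T0 (u : {linear (R^o : lmodType R) -> T0}), Add T T0 /\
    forall f : {linear (R^o : lmodType R) -> N},
      exists g : {linear T0 -> N}, forall x, g (u x) = f x.
  (* For r = 0 the coresolution says that R itself lies in Add T, and the identity serves as [u]. *)
  case: r coT => [|r] /= coT.
    have [i iE] := lin_id (R^o : lmodType R).
    by exists R^o, i; split=> // f; exists f => x; rewrite iE.
  case: coT => T0 [Y [i [p [ip aT cY]]]]; exists T0, i; split=> // f.
  exact: ext1_extend ip (eco _ _ 0%N cY) f.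
(* One copy of [T] for each map T -> N: the evaluation map is then onto, and every map T -> N lifts
   through it. *)
pose S : Type := {linear T -> N}.
have [inj [pr dD]] := dsum_is_dsum S T.
have [ev evE] := dsum_out dD (fun f : S => f).
have Tev (f : {linear T -> N}) x : exists y, ev y = f x by exists (inj f x); rewrite evE.
have evs : surj ev.
  move=> y; have [f fE] := lin_elt y; have [g gu] := ext f.
  have <- : g (u 1) = y by rewrite gu fE scale1r.
  have /AddP[S' [i [p pi]]] := aT0; rewrite -(pi (u 1)).
  have [inj' [pr' dD']] := dsum_is_dsum S' T.
  apply: (dsum_gen dD' (K := fun d => exists z, ev z = g (p d))).
    exact: (submodule_preim (g \o p) (submodule_range ev)).
  by move=> s x; exact: (Tev (g \o p \o inj' s)).
have [K [j jev]] := ses_ker evs.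
(* Higher degrees follow from the neighbouring terms; Ext^1(T, K) = 0 because each f : T -> N is the
   component of [ev] at f. *)
exists S, K, j, ev; split=> // -[|k]; last by apply: (Extz_covA jev); [exact: eN|exact: oT].
apply: (ext1_cov_lift jev); last exact: (oT 0%N).
by move=> f; exists (inj f) => x; rewrite evE.
Qed.

(* Dimension shifting along the covers of [N] by sums of copies of [T], until the
   degree exceeds pd M. *)
Lemma tilting_orth T r m M N : self_orth T -> coresd (Add T) r (R^o : lmodType R) ->
  pdle m M -> (forall k S, Extz k M (dsum S T)) -> (forall k, Extz k T N) ->
  forall k, Extz k M N.
Proof.
move=> oT coT pM eM eN k.
have [l] : exists l, (m <= k + l)%N by exists m; exact: leq_addl.
elim: l k N eN => [|l IH] k N eN ml.
  by rewrite addn0 in ml; rewrite -(subnKC ml); apply: (pdle_add nR).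
have [S [K [j [p [jp eK]]]]] := tilting_cover oT coT eN.
apply: (Extz_covC jp); first exact: eM.
by apply: IH => //; rewrite addSnnS.
Qed.

Lemma tilting_pdle T r s m M : self_orth T -> coresd (Add T) r (R^o : lmodType R) ->
  pdle s T -> pdle m M -> (forall k S, Extz k M (dsum S T)) -> pdle s M.
Proof.
move=> oT coT pT pM eM N; rewrite -[s]add0n (Extz_iter nR).
apply: (tilting_orth oT coT pM eM) => k.
by rewrite -(Extz_iter nR) addnC; apply: (pdle_add nR).
Qed.

Lemma Add_iso_closed T : iso_closed (Add T).
Proof. by apply: retract_closed_iso => X Y; exact: Add_retract. Qed.

Lemma tiltingP T : tilting T <-> exists r, [/\ pd T = Some r, self_orth T
  & coresd (Add T) r (R^o : lmodType R)].
Proof.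
split=> -[r [pT oT coT]]; exists r; split=> //.
- by move=> k S; apply/(Ext_eq0P nR)/oT.
- by apply/(coresolutionP _ _ (@Add_iso_closed T)).
- by case=> // k S _; apply/(Ext_eq0P nR)/oT.
- by move/(coresolutionP _ _ (@Add_iso_closed T)): coT.
Qed.

(** Stated for any class containing FP, so that it serves both pairs. *)
Lemma tilting_findim C T : (forall M, fin_pd M -> C M) -> tilting T ->
  (forall M, kernel (perp_pair C) M <-> Add T M) -> findim R <> None.
Proof.
move=> sC /tiltingP[r [/(pd_SomeP nR)[pT _] oT coT]] kT.
apply/inf_enat_ex; exists r => M fM m /(pd_SomeP nR)[_]; apply.
have [_ [n pM]] := (fin_pdP nR M).1 fM.
apply: (tilting_pdle oT coT pT pM) => k S.
have /kT/kernelP[_ rT] := Add_dsum S T.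
exact: (rT M (sC M fM)).
Qed.

Lemma coresd_self C n X : (forall A B, C A -> C B -> C (A * B)%type) ->
  coresd C n X -> exists T, C T /\ coresd (fun Y => retract Y T) n X.
Proof.
move=> Cp; elim: n X => [|n IH] X; first by move=> CX; exists X; split=> //; exact: retract_refl.
move=> [T0 [Y [i [p [ip CT /IH[T1 [CT1 cY]]]]]]].
exists (T0 * T1)%type; split; first exact: Cp.
have [l lE] := lin_inl T0 T1; have [q qE] := lin_fst T0 T1.
have [l' l'E] := lin_inr T0 T1; have [q' q'E] := lin_snd T0 T1.
exists T0, Y, i, p; split=> //; first by exists l, q => x; rewrite qE lE.
apply: coresd_sub cY => Z ZT1; apply: retract_trans ZT1 _.
by exists l', q' => x; rewrite q'E l'E.
Qed.

Lemma fin_pd_syz M : fin_pd M -> exists K P (i : {linear K -> P}) (p : {linear P -> M}),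
  [/\ ses i p, projective P & fin_pd K].
Proof.
move=> /(fin_pdP nR)[fM [n pM]]; have [K [m [i [p [ip fK]]]]] := fgens_presentation nR fM.
exists K, (freen R m), i, p; split=> //; first exact: projective_freen.
apply/(fin_pdP nR); split=> //; exists n => N.
rewrite -(Extz_syz nR _ _ ip); last exact: projective_freen.
exact: (pdle_mono nR (leqnSn n) pM).
Qed.

Lemma fin_pd_fgens M : fin_pd M -> fgens M.
Proof. by move=> /(fin_pdP nR)[]. Qed.

(** A bound n on FP puts the n-th cosyzygy of every module into the right class, so the bound passes
    to the whole left class. *)
Lemma perp_left_pdle n M : (forall N, fin_pd N -> pdle n N) ->
  perp_left (@fin_pd R) M -> pdle n M.
Proof.
move=> fn lM N; rewrite -[n]add0n (Extz_iter nR); apply: lM => L fL k.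
by rewrite -(Extz_iter nR) addnC; apply: (pdle_add nR); exact: fn.
Qed.

(** The invariant is Ext^i(FP, X) = 0 for i > k. The cokernel of a special preenvelope stays in the
    left class and satisfies it with k lowered by one; at k = 0 the module lies in the kernel. [n]
    and [k] count down together. *)
Lemma fin_pd_coresd n X k : perp_left (@fin_pd R) X ->
  (forall M, fin_pd M -> forall j, Extz (j + k) M X) ->
  n = k -> coresd (ker_class (@fin_pd R)) n X.
Proof.
elim: n X k => [|n IH] X k lX eX nk.
  by split=> // M fM j; move: (eX M fM j); rewrite -nk addn0.
have [L [Y [c [p [cp eL eY]]]]] := special_preenvelope nR X fin_pd_fgens.
have rL : perp_right (@fin_pd R) L by apply: perp_right_syz => //; exact: fin_pd_syz.
have lY : perp_left (@fin_pd R) Y.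
  by move=> N rN; apply: eY => M fM; exact: (rN M fM 0%N).
exists L, Y, c, p; split=> //; first by split=> //; exact: (perp_left_ses cp).
apply: (IH Y n) => // M fM j; apply: (Extz_covC cp); first exact: rL.
by rewrite -addnS nk; exact: eX.
Qed.

Lemma ker_class_prod A B : ker_class (@fin_pd R) A -> ker_class (@fin_pd R) B ->
  ker_class (@fin_pd R) (A * B)%type.
Proof.
move=> [lA rA] [lB rB]; have [i [p [ip _ _]]] := ses_prod A B.
by split; [exact: (perp_left_ses ip)|exact: (perp_right_ses ip)].
Qed.

(** The covers in the last clause are recorded for the comparison with GFP. *)
Lemma findim_tilting : findim R <> None -> exists T, [/\ tilting T,
  forall M, ker_class (@fin_pd R) M <-> Add T M
  & forall N, (forall k, Extz k T N) -> exists (S : Type) K (j : {linear K -> dsum S T})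
    (p : {linear dsum S T -> N}), ses j p /\ perp_right (@fin_pd R) K].
Proof.
move=> /inf_enat_Some[n /(findim_SomeP nR)[fn nmin]].
have [|T [[lT rT] coT]] := coresd_self (n := n) (X := R^o) ker_class_prod.
  apply: (fin_pd_coresd (k := n)) => //.
    by move=> N _; apply: ext1_proj; exact: projective_ring.
  by move=> M fM j; rewrite addnC; apply: (pdle_add nR); exact: fn.
have {}coT : coresd (Add T) n (R^o : lmodType R).
  by apply: coresd_sub coT => Y YT; apply: (Add_retract YT); exact: Add_refl.
have rTS (S : Type) : perp_right (@fin_pd R) (dsum S T).
  by apply: perp_right_dsum => //; exact: fin_pd_fgens.
have oT : self_orth T by move=> k S; exact: (perp_left_Extz lT (rTS S)).
have orth N : (forall k, Extz k T N) -> perp_right (@fin_pd R) N.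
  move=> eN M fM; have [_ [m pM]] := (fin_pdP nR M).1 fM.
  by apply: (tilting_orth oT coT pM) => // k S; exact: rTS.
have cover N : (forall k, Extz k T N) -> exists (S : Type) K (j : {linear K -> dsum S T})
    (p : {linear dsum S T -> N}), ses j p /\ perp_right (@fin_pd R) K.
  move=> /(tilting_cover oT coT)[S [K [j [p [jp eK]]]]].
  by exists S, K, j, p; split=> //; exact: orth.
exists T; split=> //.
  apply/tiltingP; exists n; split=> //; apply/(pd_SomeP nR); split.
    exact: perp_left_pdle.
  move=> m pT; apply: nmin => M fM; have [_ [l pM]] := (fin_pdP nR M).1 fM.
  by apply: (tilting_pdle oT coT pT pM) => k S; exact: rTS.
move=> M; split=> [[lM rM]|/AddP[S MS]]; last first.
  split; first by apply: (perp_left_retract MS); exact: perp_left_dsum.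
  by apply: (perp_right_retract MS); exact: rTS.
(* [M] is in the left class and the kernel of its cover in the right one, so the cover splits. *)
have [|S [K [j [p [jp rK]]]]] := cover M; first by move=> k; exact: (perp_left_Extz lT rM).
have [i iE] := lin_id M; have [h hE] := lM K rK _ _ _ _ jp i.
by apply/AddP; exists S, h, p => x; rewrite hE iE.
Qed.

End Tilting.
(** * Gorenstein projective modules *)

Section Gorenstein.
Variable R : pzRingType.
Implicit Types (A B D E F G H K L M N P Q T U V W X Y Z : lmodType R) (C : mod_class R).
Hypothesis nR : left_noetherian R.

Local Notation GP := (@Gorenstein_projective R).

Definition proj_orth G : Prop := forall k Q, projective Q -> Extz k G Q.

(* A class of this kind consists of Gorenstein projective modules, which replaces
   complete resolutions in the closure properties below. *)
Definition cosyzygy_class C : Prop := forall G, C G -> proj_orth G /\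
  exists P G' (i : {linear G -> P}) (p : {linear P -> G'}), [/\ ses i p, projective P & C G'].

(** Puts i + 1 in constructor form in each case, so that families over the integers can be defined
    by cases on the constructors. *)
Lemma int_succ_ind (F : int -> int -> Prop) :
  (forall n : nat, F n n.+1) -> F (Negz 0) 0 -> (forall n : nat, F (Negz n.+1) (Negz n)) ->
  forall i : int, F i (i + 1).
Proof.
move=> Fp F0 Fn [n|[|n]].
- by rewrite (_ : Posz n + 1 = n.+1)// -addn1 PoszD.
- exact: F0.
- by rewrite (_ : Negz n.+1 + 1 = Negz n)// !NegzE -addn1 PoszD opprD addrNK.
Qed.

(** The complex is spliced from [Z]: cosyzygies in [C] at nonnegative indices, and at [Negz n], that
    is -(n + 1), the syzygy of order n + 1. Exactness of Hom into Q comes from Ext^1(Z i, Q) = 0,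
    which at negative i is a higher Ext of [G]. *)
Lemma GP_of_cosyzygy_class C G : cosyzygy_class C -> C G -> GP G.
Proof.
move=> gC CG; pose S := {X | C X}.
have nextP (t : S) : exists (t' : S) P (i : {linear sval t -> P}) (p : {linear P -> sval t'}),
    projective P /\ ses i p.
  have [_ [P [G' [i [p [ip pP CG']]]]]] := gC _ (svalP t).
  by exists (exist _ G' CG'), P, i, p.
pose next t := projT1 (cid (nextP t)).
pose z k : S := iter k next (exist _ G CG).
pose Z (i : int) : lmodType R :=
  match i with Posz n => sval (z n) | Negz n => iter n.+1 (@syz R) G end.
have ZP : forall i, exists P (u : {linear Z i -> P}) (p : {linear P -> Z (i + 1)}),
    projective P /\ ses u p.
  apply: (@int_succ_ind (fun i j => exists P (u : {linear Z i -> P}) (p : {linear P -> Z j}),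
      projective P /\ ses u p)) => [n||n] /=.
  - exact: (projT2 (cid (nextP (z n)))).
  - exact: syzP.
  - exact: syzP.
have Zorth i Q : projective Q -> ext1 (Z i) Q.
  move=> pQ; case: i => n; last exact: ((gC _ CG).1 n.+1 Q pQ).
  exact: ((gC _ (svalP (z n))).1 0%N Q pQ).
pose P i := projT1 (cid (ZP i)).
have uP i : exists (u : {linear Z i -> P i}) (p : {linear P i -> Z (i + 1)}),
  projective (P i) /\ ses u p := projT2 (cid (ZP i)).
pose u i := projT1 (cid (uP i)).
have pP i : exists (p : {linear P i -> Z (i + 1)}), projective (P i) /\ ses (u i) p :=
  projT2 (cid (uP i)).
pose p i := projT1 (cid (pP i)).
have PP i : projective (P i) /\ ses (u i) (p i) := projT2 (cid (pP i)).
have up i : ses (u i) (p i) by case: (PP i).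
have ui i : injective (u i) by case: (up i).
have ps i : surj (p i) by case: (up i).
have u0 i x : u i x = 0 -> x = 0 by move=> ux; apply: (ui i); rewrite ux linear0.
exists P, (fun i => u (i + 1) \o p i); split.
- by move=> i; case: (PP i).
- move=> i y /=; have [_ e _] := up (i + 1); split=> [/u0/e[x <-]|[x <-]].
    by have [w <-] := ps i x; exists w.
  by rewrite (ses0 _ (up _)) linear0.
- move=> Q pQ i f; split=> [f0|[g gE] x]; last first.
    by rewrite gE /= (ses0 _ (up _)) !linear0.
  have [|g gE] := ses_out (h := f) (up (i + 1)).
    by move=> x; have [w <-] := ps i x; exact: f0.
  have [h hE] := ext1_extend (up (i + 1 + 1)) (Zorth _ _ pQ) g.
  by exists h => x; rewrite /= hE gE.
- exists (u 0); split; first exact: (ui 0).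
  move=> y /=; have [_ e _] := up 0; split=> [/u0/e|/e ->]; last by rewrite linear0.
  by [].
Qed.

(** The kernel of one differential has the kernel of the preceding one as a syzygy, so the degree
    drops while the index moves left; in the lowest degree exactness of Hom(P, Q) extends maps from
    the syzygy. *)
Lemma GP_orth_aux (P : int -> lmodType R) (d : forall i, {linear P i -> P (i + 1)}) :
  (forall i, projective (P i)) -> (forall i, exact (d i) (d (i + 1))) ->
  (forall Q, projective Q -> forall i (f : {linear P (i + 1) -> Q}),
    (forall x, f (d i x) = 0) <->
    exists g : {linear P (i + 1 + 1) -> Q}, forall x, f x = g (d (i + 1) x)) ->
  forall k i G (u : {linear G -> P i}), injective u -> exact u (d i) ->
  forall Q, projective Q -> Extz k G Q.
Proof.
move=> pP ed hd.
have pred_ex i G (u : {linear G -> P (i + 1)}) : injective u -> exact u (d (i + 1)) ->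
    exists K (j : {linear K -> P i}) (p : {linear P i -> G}),
    [/\ ses j p, exact j (d i) & forall x, u (p x) = d i x].
  move=> ui ue; have [p pE] := factor_inj (g := d i) ui
    (fun x => (ue _).1 ((ed i _).2 (ex_intro _ x erefl))).
  have ps : surj p.
    move=> y; have /ed[x dx] : d (i + 1) (u y) = 0 by apply/ue; exists y.
    by exists x; apply: ui; rewrite pE.
  have [K [j jp]] := ses_ker ps; exists K, j, p; split=> // x.
  have [_ <- _] := jp; rewrite -pE; split=> [px|->]; last by rewrite linear0.
  by apply: ui; rewrite px linear0.
elim=> [|k IH] i G u ui ue Q pQ.
  (* Two steps lead left from [P i], to an index where the condition on Hom(P, Q) needs one more
     successor. *)
  have [l il] : exists l, i = l + 1 + 1 + 1 by exists (i - 1 - 1 - 1); rewrite !subrK.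
  subst i; have [K [j [p [jp je uE]]]] := pred_ex _ _ _ ui ue.
  have [ji _ _] := jp; have [K' [j' [p' [jp' je' jE]]]] := pred_ex _ _ _ ji je.
  apply: (ext1_pres jp (pP _)) => f.
  have [g gE] : exists g : {linear P (l + 1 + 1) -> Q}, forall x, (f \o p') x = g (d (l + 1) x).
    apply: (hd Q pQ l (f \o p')).1 => x /=; suff -> : p' (d l x) = 0 by rewrite linear0.
    by apply: ji; rewrite jE linear0; apply/ed; exists x.
  have [_ _ ps'] := jp'; exists g.
  by apply: (surj_lin_eq (h := g \o j) (k := f) ps') => x /=; rewrite jE -gE.
have [l il] : exists l, i = l + 1 by exists (i - 1); rewrite subrK.
subst i; have [K [j [p [jp je uE]]]] := pred_ex _ _ _ ui ue.
have [ji _ _] := jp.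
by rewrite (Extz_syz nR _ _ jp (pP _)); exact: (IH l K j ji je Q pQ).
Qed.

Lemma GP_orth G : GP G -> proj_orth G.
Proof.
move=> [P [d [pP ed hd [u [ui ue]]]]] k Q pQ.
exact: (GP_orth_aux pP ed hd ui ue).
Qed.

Lemma GP_step G : GP G -> exists P G' (i : {linear G -> P}) (p : {linear P -> G'}),
  [/\ ses i p, projective P & GP G'].
Proof.
move=> [P [d [pP ed hd [u [ui ue]]]]].
have [G' [p up]] := ses_coker ui; exists (P 0), G', u, p; split=> //.
have [|v vE] := ses_out (h := d 0) up; first by move=> x; apply/ue; exists x.
exists (fun i => P (i + 1)), (fun i => d (i + 1)); split=> //.
- by move=> Q pQ i; exact: (hd Q pQ (i + 1)).
- have [_ pe ps] := up; exists v; split.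
    apply: inj0P => y; have [x <-] := ps y; rewrite vE => /ue[g <-].
    exact: (ses0 _ up).
  move=> y; rewrite (ed 0 y); split=> [[x <-]|[x <-]]; first by exists (p x).
  by have [w <-] := ps x; exists w.
Qed.

(** Adjoining [G] to the Gorenstein projective modules gives a cosyzygy class. *)
Lemma GP_intro G P G' (i : {linear G -> P}) (p : {linear P -> G'}) :
  proj_orth G -> ses i p -> projective P -> GP G' -> GP G.
Proof.
move=> oG ip pP gG'; apply: (@GP_of_cosyzygy_class (fun A => GP A \/ A = G)); last by right.
move=> A [gA|->]; last by split=> //; exists P, G', i, p; split=> //; left.
split; first exact: GP_orth.
have [P0 [A' [j [q [jq pP0 gA']]]]] := GP_step gA.
by exists P0, A', j, q; split=> //; left.
Qed.

Lemma GP_iso_closed : iso_closed GP.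
Proof.
move=> A B f fi fs [P [d [pP ed hd [u [ui ue]]]]].
have [g [gi gs]] := iso_inv fi fs.
exists P, d; split=> //; exists (u \o g); split; first by move=> x y /ui/gi.
move=> y; rewrite ue; split=> [[x <-]|[x <-]]; last by exists (g x).
by have [w <-] := gs x; exists w.
Qed.

Lemma GP_projective P : projective P -> GP P.
Proof.
apply: GP_of_cosyzygy_class => Q pQ; split=> [k L pL|]; first exact: (Extz_proj nR).
have [i iE] := lin_id Q; have [z zE] := lin_zero Q (freen R 0).
exists Q, (freen R 0), i, z; split=> //; last exact: projective_freen.
split=> [x y|y|y]; first by rewrite !iE.
  by split=> // _; exists y; rewrite iE.
by exists 0; rewrite linear0; apply/esym/(@freen0_trivial R).
Qed.

Lemma projective_prod A B : projective A -> projective B -> projective (A * B)%type.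
Proof.
move=> pA pB X Y p f ps; have [l lE] := lin_inl A B; have [r rE] := lin_inr A B.
have [g gE] := proj_lift (f \o l) pA ps; have [h hE] := proj_lift (f \o r) pB ps.
have [c cE] := lin_copair g h; exists c => -[x y].
rewrite cE linearD gE hE /= -linearD; congr (f _).
by rewrite lE rE; congr pair; rewrite /= ?addr0 ?add0r.
Qed.

(** The extensions of Gorenstein projective modules form a cosyzygy class, by the horseshoe lemma
    for cosyzygies: A -> P extends to [B] because Ext^1(D, P) = 0. *)
Lemma GP_ses A B D (i : {linear A -> B}) (p : {linear B -> D}) :
  ses i p -> GP A -> GP D -> GP B.
Proof.
move=> ip gA gD; apply: (@GP_of_cosyzygy_class (fun B => exists A D (i : {linear A -> B})
  (p : {linear B -> D}), [/\ ses i p, GP A & GP D])); last by exists A, D, i, p.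
move=> {ip gA gD A D i p}B' [A [D [i [p [ip gA gD]]]]]; split.
  by move=> k Q pQ; apply: (Extz_conB nR ip); exact: GP_orth.
have [P [A' [u [q [uq pP gA']]]]] := GP_step gA.
have [P' [D' [u' [q' [uq' pP' gD']]]]] := GP_step gD.
have [e eE] := ext1_extend ip (GP_orth (k := 0%N) gD pP) u.
have [v vE] := lin_pair e (u' \o p).
have [ui _ qs] := uq; have [ui' ue' qs'] := uq'; have [ii ie ps] := ip.
have vi : injective v.
  apply: inj0P => b; rewrite vE /= => -[eb ub].
  have /ie[a ab] : p b = 0 by apply: ui'; rewrite ub linear0.
  move: eb; rewrite -ab eE => ua.
  by rewrite (ui a 0) ?linear0.
have [B0 [w vw]] := ses_coker vi; have [_ we ws] := vw.
exists (P * P')%type, B0, v, w; split=> //; first exact: projective_prod.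
have [l lE] := lin_inl P P'; have [s sE] := lin_snd P P'.
have [|f fE] := ses_out (h := w \o l) uq.
  move=> a; apply/we; exists (i a).
  by rewrite vE eE /= (ses0 _ ip) linear0 lE.
have [|g gE] := ses_out (h := q' \o s) vw.
  by move=> b; rewrite /= sE vE /= (ses0 _ uq').
exists A', D', f, g; split=> //; split.
- apply: inj0P => x; have [y <-] := qs x; rewrite fE /= => /we[b].
  rewrite vE lE => -[eb ub].
  have /ie[a ab] : p b = 0 by apply: ui'; rewrite ub linear0.
  by move: eb; rewrite -ab eE => <-; exact: (ses0 _ uq).
- move=> x; have [[y y'] <-] := ws x; rewrite gE /= sE /=; split.
    move=> /ue'[d du]; have [b pb] := ps d.
    exists (q (y - e b)); rewrite fE /= lE; apply/subr0_eq; rewrite -linearB; apply/we.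
    exists (- b); rewrite linearN vE /= pb du; congr pair => /=.
      by rewrite addrAC subrr sub0r.
    by rewrite sub0r.
  move=> [a]; have [b <-] := qs a; rewrite fE /= lE => e1.
  have /we[c] : w ((y, y') - (b, 0)) = 0 by rewrite linearB e1 subrr.
  rewrite vE => -[_]; rewrite subr0 => <-; exact: (ses0 _ uq').
- by move=> d; have [y <-] := qs' d; exists (w (0, y)); rewrite gE /= sE.
Qed.

(** Embed [E] in a projective P with Gorenstein projective cokernel. Then P/K is an extension of P/E
    by E/K = G, hence Gorenstein projective, and K is its kernel in P. *)
Lemma GP_ker K E G (i : {linear K -> E}) (p : {linear E -> G}) :
  ses i p -> GP E -> GP G -> GP K.
Proof.
move=> ip gE gG; have [P [E' [j [q [jq pP gE']]]]] := GP_step gE.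
have [ii ie ps] := ip; have [ji je qs] := jq.
have jii : injective (j \o i) by move=> x y /= /ji/ii.
have [K' [r jr]] := ses_coker jii; have [_ re rs] := jr.
apply: (GP_intro (i := j \o i) (p := r)) => //.
  by move=> k Q pQ; apply: (Extz_conA nR ip); exact: GP_orth.
have [|f fE] := ses_out (h := r \o j) ip; first by move=> x; apply/re; exists x.
have [|g gq] := ses_out (h := q) jr; first by move=> x; exact: (ses0 _ jq).
apply: (GP_ses (i := f) (p := g)) => //; split.
- apply: inj0P => x; have [y <-] := ps x; rewrite fE /= => /re[k /= /ji <-].
  exact: (ses0 _ ip).
- move=> x; have [y <-] := rs x; rewrite gq; split.
    by move=> /je[e <-]; exists (p e); rewrite fE.
  move=> [w]; have [e <-] := ps w; rewrite fE /= => e1.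
  have /re[k /= kE] : r (y - j e) = 0 by rewrite linearB e1 subrr.
  by apply/je; exists (i k + e); rewrite linearD kE subrK.
- by move=> x; have [y <-] := qs x; exists (r y); rewrite gq.
Qed.

Lemma fgens_prod A B : fgens A -> fgens B -> fgens (A * B)%type.
Proof. by have [i [p [ip _ _]]] := ses_prod A B; exact: fgens_ses ip. Qed.

(* Replaces the embedding of a finitely generated submodule of a free module into
   a summand of finite rank. *)
Lemma projective_finite_factor P (s : seq P) : projective P ->
  exists F (a : {linear P -> F}) (b : {linear F -> P}),
    [/\ projective F, fgens F & forall x, x \in s -> b (a x) = x].
Proof.
move=> pP.
have [D [inj [pr dD]]] := is_dsum_ex (fun _ : P => R^o : lmodType R).
have H (m : P) : exists h : {linear R^o -> P}, forall r : R, h r = r *: m := lin_elt m.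
have [h hE] := dsum_out dD (fun m => projT1 (cid (H m))).
have hs : surj h.
  move=> m; exists (inj m 1); rewrite hE; case: (cid _) => /= g ->.
  by rewrite scale1r.
have [idP idE] := lin_id P; have [c cE] := proj_lift idP pP hs.
have fact (t : seq {classic P}) : exists F (a : {linear D -> F}) (b : {linear F -> D}),
    [/\ projective F, fgens F &
     forall d, (forall m : {classic P}, pr m d <> 0 -> m \in t) -> b (a d) = d].
  elim: t => [|m t [F [a [b [pF fF ab]]]]].
    have [a aE] := lin_zero D (freen R 0); have [b bE] := lin_zero (freen R 0) D.
    exists (freen R 0), a, b; split; [exact: projective_freen|exact: fgens_freen|].
    move=> d d0; rewrite bE; apply/esym/(dsum_ext dD) => i.
    by apply: contrapT => /(d0 i).
  have [e eE'] := lin_id D.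
  have [g gE] := lin_sub e (inj m \o pr m).
  have [a' aE'] := lin_pair (pr m) (a \o g); have [b' bE'] := lin_copair (inj m) b.
  exists (R^o * F)%type, a', b'; split.
  - exact: projective_prod (@projective_ring R) pF.
  - exact: fgens_prod (@fgens_ring R) fF.
  move=> d dt; rewrite bE' aE' /= ab.
    by rewrite gE eE' /= addrC subrK.
  move=> k; rewrite gE eE' /= linearB; have [km|km] := pselect (k = m).
    by rewrite km (dsum_prK dD) subrr.
  rewrite (dsum_pr0 dD)// subr0 => /dt; rewrite inE => /orP[/eqP|//].
  by move=> e'; case: km.
have [t tP] : exists t : seq {classic P}, forall x, x \in s ->
    forall m : {classic P}, pr m (c x) <> 0 -> m \in t.
  elim: s => [|x s [t tP]]; first by exists [::].
  have [t' [_ tP']] := dsum_seq dD (c x); exists (t' ++ t) => y.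
  by rewrite inE => /orP[/eqP -> m /tP' mt|/tP yt m /yt mt]; rewrite mem_cat ?mt ?orbT//.
have [F [a [b [pF fF ab]]]] := fact t.
exists F, (a \o c), (h \o b); split=> // x xs.
by rewrite /= ab ?cE ?idE//; exact: tP.
Qed.

(** For the embedding of [M] in F through P, with cokernel C, a Schanuel argument gives 0 -> F -> C
    * P -> M1 -> 0, where M1 = P/M. So C * P is Gorenstein projective, and C is the kernel of its
    projection onto P. *)
Lemma GP_fgens_step M : GP M -> fgens M -> exists F M' (j : {linear M -> F})
  (q : {linear F -> M'}), [/\ ses j q, projective F, fgens F & GP M'].
Proof.
move=> gM [s sP]; have [P [M1 [u [r [ur pP gM1]]]]] := GP_step gM.
have [F [a [b [pF fF ab]]]] := projective_finite_factor [seq u x | x <- s] pP.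
have bau m : b (a (u m)) = u m.
  apply: (sP _ (submodule_eq (b \o a \o u) u)) => x xs.
  by apply: ab; exact: map_f.
have [ui ue rs] := ur.
have ji : injective (a \o u).
  by move=> x y /= /(congr1 b); rewrite !bau => /ui.
have [C [q jq]] := ses_coker ji; have [_ je qs] := jq.
exists F, C, (a \o u), q; split=> //.
have [i [p [ip iE pE]]] := ses_prod C P.
apply: (GP_ker ip); last exact: GP_projective.
have [v vE] := lin_pair q b.
have [f fE] := lin_snd C P; have [g gE] := lin_fst C P.
have [|c cE] := ses_out (h := r \o b) jq.
  by move=> m; rewrite /= bau (ses0 _ ur).
have [w wE] := lin_sub (r \o f) (c \o g).
apply: (GP_ses (i := v) (p := w)) => //; last exact: GP_projective.
split.
- apply: inj0P => x; rewrite vE => -[/je[m <-]] /=; rewrite bau => um.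
  by rewrite um linear0.
- move=> [x y]; have [z <-] := qs x; rewrite wE /= fE gE /= cE /=; split.
    rewrite -linearB => /ue[m mE]; exists (z + a (u m)).
    rewrite vE !linearD bau mE; congr pair => /=.
      by rewrite -mE (ses0 m jq : q (a (u m)) = 0) addr0.
    by rewrite addrC subrK.
  move=> [t]; rewrite vE => -[qt <-].
  have /je[m mE] : q (z - t) = 0 by rewrite linearB qt subrr.
  by rewrite -linearB -linearB -opprB linearN -mE /= bau linearN (ses0 _ ur) oppr0.
- by move=> m; have [x <-] := rs m; exists (0, x); rewrite wE /= fE gE /= linear0 subr0.
Qed.

(** The kernel of G0 -> E -> G is Gorenstein projective and maps onto [K] with the same kernel N as
    G0 -> E, so the tail of the resolution is kept. *)
Lemma resd_GP_ker n K E G (i : {linear K -> E}) (p : {linear E -> G}) :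
  ses i p -> GP G -> resd GP n E -> resd GP n K.
Proof.
move=> ip gG; case: n => [|n] /=; first by move=> gE; exact: GP_ker ip gE gG.
move=> [N [G0 [nu [pi [np gG0 rN]]]]].
have [ii ie ps] := ip; have [ni ne pis] := np.
have sp : surj (p \o pi).
  by move=> g; have [e <-] := ps g; have [x <-] := pis e; exists x.
have [G1 [k kp]] := ses_ker sp; have [ki ke _] := kp.
have [|f fE] := ses_in (h := pi \o k) ip; first by move=> x; exact: (ses0 _ kp).
have [|h hE] := ses_in (h := nu) kp.
  by move=> x; rewrite /= (ses0 _ np) linear0.
exists N, G1, h, f; split=> //; last exact: GP_ker kp gG0 gG.
split.
- by move=> x y e; apply: ni; rewrite -!hE e.
- move=> y; split=> [fy|[x <-]].
    have /ne[x xE] : pi (k y) = 0 by rewrite -[pi _]fE fy linear0.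
    by exists x; apply: ki; rewrite hE.
  by apply: ii; rewrite fE /= hE linear0 (ses0 _ np).
- move=> x; have [y yE] := pis (i x).
  have /ke[z zE] : (p \o pi) y = 0 by rewrite /= yE (ses0 _ ip).
  by exists z; apply: ii; rewrite fE /= zE.
Qed.

Lemma resd_GP_prod n N F : projective F -> resd GP n N -> resd GP n (N * F)%type.
Proof.
move=> pF; have gF := GP_projective pF; case: n => [|n] /=.
  by have [i [p [ip _ _]]] := ses_prod N F => gN; exact: GP_ses ip gN gF.
move=> [N' [G0 [nu [pi [np gG0 rN]]]]]; have [ni ne pis] := np.
have [l lE] := lin_inl G0 F; have [f fE] := lin_fst G0 F; have [s sE] := lin_snd G0 F.
have [q qE] := lin_pair (pi \o f) s.
have [i [p [ip _ _]]] := ses_prod G0 F.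
exists N', (G0 * F)%type, (l \o nu), q; split=> //; last exact: GP_ses ip gG0 gF.
split.
- by move=> x y /=; rewrite !lE => -[/ni].
- move=> [x y]; rewrite qE /= fE sE /=; split=> [[/ne[z <-] ->]|[z]].
    by exists z; rewrite lE.
  by rewrite lE => -[<- <-]; rewrite (ses0 _ np).
- move=> [x y]; have [z <-] := pis x; exists (z, y).
  by rewrite qE /= fE sE.
Qed.

(* The kernel of the joint surjection N + F -> G0 is [K]. *)
Lemma resd_GP_syz n K F M (i : {linear K -> F}) (p : {linear F -> M}) :
  ses i p -> projective F -> resd GP n.+1 M -> resd GP n K.
Proof.
move=> ip pF [N [G0 [nu [pi [np gG0 rN]]]]].
have [ii ie ps] := ip; have [ni ne pis] := np.
have [s sE] := proj_lift p pF pis.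
have [|t tE] := ses_in (h := s \o i) np; first by move=> x; rewrite /= sE (ses0 _ ip).
have [z zE] := lin_zero K N; have [t' tE'] := lin_sub z t.
have [j jE] := lin_pair t' i; have [m mE] := lin_copair nu s.
apply: (resd_GP_ker (i := j) (p := m) _ gG0 (resd_GP_prod pF rN)); split.
- by move=> x y; rewrite !jE => -[_ /ii].
- move=> [x y]; rewrite mE /=; split=> [xy|[k]].
    have /ie[k ky] : p y = 0.
      by have := congr1 pi xy; rewrite linearD (ses0 _ np) add0r sE linear0.
    exists k; rewrite jE ky; congr pair; apply: ni.
    rewrite tE' zE sub0r linearN tE /= ky; apply/esym/eqP.
    by rewrite -addr_eq0 xy.
  rewrite jE => -[<- <-]; rewrite tE' zE sub0r linearN tE /=.
  by rewrite addrC subrr.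
- move=> g; have [y yE] := ps (pi g).
  have /ne[x xE] : pi (g - s y) = 0 by rewrite linearB sE yE subrr.
  by exists (x, y); rewrite mE /= xE subrK.
Qed.

(** Approximate the syzygy K by 0 -> K -> H -> G -> 0 and push out along K -> R^m. The pushout D is
    Gorenstein projective as an extension of G by R^m, and D/H = M. Embedding D in a finitely
    generated projective F with Gorenstein projective cokernel gives 0 -> M -> F/H -> F/D -> 0,
    where F/H has finite projective dimension because H has. *)
Lemma fgens_GP_approx n M : fgens M -> resd GP n M -> exists H G (i : {linear M -> H})
  (p : {linear H -> G}), [/\ ses i p, fin_pd H, GP G & fgens G].
Proof.
elim: n M => [|n IH] M fM.
  move=> gM; have [F [C [j [q [jq pF fF gC]]]]] := GP_fgens_step gM fM.
  exists F, C, j, q; split=> //; last by case: jq => _ _ qs; exact: fgens_surj qs fF.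
  by apply/(fin_pdP nR); split=> //; exists 0%N => N; exact: ext1_proj.
move=> rM; have [K [m [i [p [ip fK]]]]] := fgens_presentation nR fM.
have rK := resd_GP_syz ip (@projective_freen R m) rM.
have [H [G [f [g [fg fH gG fgG]]]]] := IH K fK rK.
have [D [a [h pD]]] := pushout_ex i f.
have [q [hq qa]] := pushout_ses pD ip.
have [q' [aq _]] := pushout_ses (pushout_sym pD) fg.
have gD : GP D by apply: (GP_ses aq) => //; apply: GP_projective; exact: projective_freen.
have fD : fgens D by apply: (fgens_ses aq) => //; exact: fgens_freen.
have [F [C [j [r [jr pF fF gC]]]]] := GP_fgens_step gD fD.
have [ji je rs] := jr; have [hi he qs] := hq.
have jhi : injective (j \o h) by move=> x y /= /ji/hi.
have [H' [s js]] := ses_coker jhi; have [_ se ss] := js.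
have [|u uE] := ses_out (h := s \o j) hq; first by move=> x; apply/se; exists x.
have [|v vE] := ses_out (h := r) js; first by move=> x; exact: (ses0 _ jr).
exists H', C, u, v; split=> //.
- split.
  + apply: inj0P => x; have [y <-] := qs x; rewrite uE /= => /se[k /= /ji <-].
    exact: (ses0 _ hq).
  + move=> x; have [y <-] := ss x; rewrite vE; split.
      by move=> /je[e <-]; exists (q e); rewrite uE.
    move=> [w]; have [e <-] := qs w; rewrite uE /= => e1.
    have /se[k /= kE] : s (y - j e) = 0 by rewrite linearB e1 subrr.
    by apply/je; exists (h k + e); rewrite linearD kE subrK.
  + by move=> x; have [y <-] := rs x; exists (s y); rewrite vE.
- have [fH' [k pH]] := (fin_pdP nR H).1 fH.
  apply/(fin_pdP nR); split; first exact: fgens_surj ss fF.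
  by exists k.+1 => N; rewrite (Extz_syz nR _ _ js pF).
- exact: fgens_surj rs fF.
Qed.

Lemma GP_orth_resd n k G M : GP G -> resd (@projective R) n M -> Extz k G M.
Proof.
move=> gG; elim: n k M => [|n IH] k M; first exact: GP_orth.
move=> [K [P [i [p [ip pP rK]]]]].
by apply: (Extz_covC ip); [exact: GP_orth|exact: IH].
Qed.

Lemma fin_GpdP M : fin_Gpd M <-> fgens M /\ exists n, resd GP n M.
Proof.
rewrite /fin_Gpd finitely_generatedP /Gpd inf_enat_ex.
by split=> -[fM [n rM]]; split=> //; exists n; apply/(res_dim_leP _ _ GP_iso_closed).
Qed.

Lemma fin_pd_Gpd M : fin_pd M -> fin_Gpd M.
Proof.
move=> /(fin_pdP nR)[fM [n /(pdle_resd nR) rM]]; apply/fin_GpdP; split=> //.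
by exists n; apply: resd_sub rM => P; exact: GP_projective.
Qed.

Lemma findim_tilting_Gpd : findim R <> None -> exists T, tilting T /\
  forall M, ker_class (@fin_Gpd R) M <-> Add T M.
Proof.
move=> fR; have [T [tT kT cT]] := findim_tilting nR fR; exists T; split=> //.
have [n /(findim_SomeP nR)[fn _]] := (inf_enat_Some _).1 fR.
have approx G : fin_Gpd G -> exists H G' (i : {linear G -> H}) (p : {linear H -> G'}),
    [/\ ses i p, fin_pd H, GP G' & fin_Gpd G'].
  move=> /fin_GpdP[fG [m rG]]; have [H [G' [i [p [ip fH gG' fG']]]]] := fgens_GP_approx fG rG.
  by exists H, G', i, p; split=> //; apply/fin_GpdP; split=> //; exists 0%N.
(* Modules of Add T have projective dimension at most n, so Ext^i(G', -) vanishes on them, and the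
   approximation G -> H -> G' carries vanishing from H to G. *)
have rT M : Add T M -> perp_right (@fin_Gpd R) M.
  move=> /kT[lM rM] G fG k; have [H [G' [i [p [ip fH gG' fG']]]]] := approx G fG.
  apply: (Extz_conA nR ip); first exact: rM.
  by apply: (GP_orth_resd (n := n)) => //; apply/(pdle_resd nR); exact: (perp_left_pdle nR fn).
move=> M; split=> [[lM rM]|aM]; last first.
  split; last exact: rT.
  have [lM _] := (kT M).2 aM; move=> N rN; apply: lM => H fH.
  exact: (rN H (fin_pd_Gpd fH)).
have rM' : perp_right (@fin_pd R) M by move=> H fH; exact: (rM H (fin_pd_Gpd fH)).
have [lT _] := (kT T).2 (Add_refl T).
have [|S [K [j [p [jp rK]]]]] := cT M; first by move=> k; exact: (perp_left_Extz nR lT rM').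
(* Ext^(k+1)(G, K) sits between Ext^(k+1)(H, K) and Ext^(k+2)(G', K), and the latter between
   Ext^(k+1)(G', M) and Ext^(k+2)(G', -) of the sum of copies of [T]; all outer terms vanish. *)
have rK' : perp_right (@fin_Gpd R) K.
  move=> G fG k; have [H [G' [i [q [iq fH gG' fG']]]]] := approx G fG.
  apply: (Extz_conA nR iq); first exact: rK.
  apply: (Extz_covA jp); first exact: rM.
  exact: (rT _ (Add_dsum S T) G' fG').
have [i iE] := lin_id M; have [h hE] := lM K rK' _ _ _ _ jp i.
by apply/AddP; exists S, h, p => x; rewrite hE iE.
Qed.

End Gorenstein.
Theorem theorem1p2 (R : pzRingType) (noethR : left_noetherian R) :
  (findim R <> None <->
     exists T : lmodType R, tilting T /\
       forall M : lmodType R,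
         kernel (perp_pair (@fin_pd R)) M <-> Add T M) /\
  (findim R <> None <->
     exists T : lmodType R, tilting T /\
       forall M : lmodType R,
         kernel (perp_pair (@fin_Gpd R)) M <-> Add T M).
Proof.
split; split.
- move=> /(findim_tilting noethR)[T [tT kT _]]; exists T; split=> // M.
  by rewrite (kernelP noethR).
- move=> [T [tT kT]]; exact: (tilting_findim noethR (fun _ => id) tT kT).
- move=> /(findim_tilting_Gpd noethR)[T [tT kT]]; exists T; split=> // M.
  by rewrite (kernelP noethR).
- move=> [T [tT kT]]; exact: (tilting_findim noethR (fin_pd_Gpd noethR) tT kT).
Qed.
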